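(* Let $\beta=\tfrac52$. There is $\gamma_0>\tfrac12$ such that for every $\gamma\in(\tfrac12,\gamma_0]$ the following holds. Let $x=(x_n)_{n\ge1}$ be a real sequence with $x_n\ge0$ for all $n\ge1$ and $\sup_{n\ge1}(\lambda_n^\gamma x_n)<\infty$. Then there is a global in time solution $X=(X_n)_{n\ge1}$ on $[0,\infty)$ of the inviscid dyadic problem $$\dot X_n=\lambda_{n-1}^\beta X_{n-1}^2-\lambda_n^\beta X_nX_{n+1},\qquad X_n(0)=x_n,\qquad n\ge1,\ t\ge0,$$ such that $$\sup_{t\ge0}\Bigl(\sup_{n\ge1}\lambda_n^\gamma X_n(t)\Bigr)<\infty,$$ and $X$ is unique in the class of solutions (with initial condition $x$) satisfying this bound. Moreover, $X$ is the unique vanishing viscosity limit: if, for $\nu>0$, $X^{[\nu]}=(X^{[\nu]}_n)_{n\ge1}$ denotes the (unique) solution of the viscous problem $$\dot X_n=-\nu\lambda_n^2X_n+\lambda_{n-1}^\beta X_{n-1}^2-\lambda_n^\beta X_nX_{n+1},\qquad X_n(0)=x_n,\qquad n\ge1,\ t\ge0,$$ then for every $n\ge1$, $X^{[\nu]}_n\to X_n$ as $\nu\to0$, uniformly in time on compact subsets of $[0,\infty)$.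
   Context: Notation: $\lambda=2$, $\lambda_n=\lambda^n=2^n$ for $n\ge1$, and $\lambda_0=0$ (so the term $\lambda_0^\beta X_0^2$ in the equation for $n=1$ is zero). A solution of either the inviscid or the viscous problem is a sequence $X=(X_n)_{n\ge1}$ of real-valued functions, each $X_n$ continuously differentiable in time, such that the equations and the initial conditions hold for every $n\ge1$. For $\beta=\tfrac52$, $\nu>0$ and non-negative square-summable initial data, the viscous problem has a unique solution on $[0,\infty)$; the $x$ considered here is square-summable because $\gamma>0$. *)

(* Defs.v *)
From mathcomp Require Import all_boot all_order all_algebra.
From mathcomp Require Import all_classical all_reals all_analysis.

Set Implicit Arguments.
Unset Strict Implicit.
Unset Printing Implicit Defensive.

Import Order.TTheory GRing.Theory Num.Theory.
Import numFieldNormedType.Exports.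
Local Open Scope classical_set_scope.
Local Open Scope ring_scope.

(* The value at 0 is 0, not 2 ^+ 0; with the convention 0 `^ b = 0 for b != 0,
   the terms below in which [lam R 0] occurs vanish. *)
Definition lam (R : realType) (n : nat) : R := if n is 0%N then 0 else 2 ^+ n.

(* Sequences (u_n)_{n >= 1} are functions on nat whose value at 0 is junk:
   every condition below is imposed for n >= 1 only. Likewise, functions on
   [0, +oo[ are functions on R whose values at t < 0 are junk. *)

(* At the end point t = 0 this is the one-sided derivative. *)
Definition has_derivative_nneg (R : realType) (f : R -> R) (t l : R) : Prop :=
  (f s - f t) / (s - t) @[s --> within `[0, +oo[ t^'] --> l.

Definition C1_nneg (R : realType) (f f' : R -> R) : Prop :=
  {within `[0, +oo[, continuous f'} /\
  forall t, 0 <= t -> has_derivative_nneg f t (f' t).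

Definition inviscid_rhs (R : realType) (beta : R) (n : nat) (u : nat -> R) : R :=
  lam R n.-1 `^ beta * u n.-1 ^+ 2 - lam R n `^ beta * u n * u n.+1.

Definition viscous_rhs (R : realType) (beta nu : R) (n : nat) (u : nat -> R) : R :=
  - nu * lam R n ^+ 2 * u n
  + lam R n.-1 `^ beta * u n.-1 ^+ 2 - lam R n `^ beta * u n * u n.+1.

Definition solves (R : realType) (F : nat -> (nat -> R) -> R)
    (x : nat -> R) (X : nat -> R -> R) : Prop :=
  forall n, (1 <= n)%N ->
    X n 0 = x n /\ C1_nneg (X n) (fun t => F n (fun k => X k t)).

Definition inviscid_solution (R : realType) (beta : R)
    (x : nat -> R) (X : nat -> R -> R) : Prop :=
  solves (inviscid_rhs beta) x X.

Definition viscous_solution (R : realType) (beta nu : R)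
    (x : nat -> R) (X : nat -> R -> R) : Prop :=
  solves (viscous_rhs beta nu) x X.

(* No absolute values: solutions with non-negative initial data remain
   non-negative. *)
Definition sup_lam (R : realType) (gamma : R) (u : nat -> R) : \bar R :=
  ereal_sup [set (lam R n `^ gamma * u n)%:E | n in [set n | (1 <= n)%N]].

Definition sup_lam_time (R : realType) (gamma : R) (X : nat -> R -> R) : \bar R :=
  ereal_sup [set sup_lam gamma (fun n => X n t) | t in [set t : R | 0 <= t]].

(* Main.v *)
Require Import Defs.
From mathcomp Require Import all_boot all_order all_algebra.
From mathcomp Require Import all_classical all_reals all_analysis.
From mathcomp Require Import ring lra.

Set Implicit Arguments.
Unset Strict Implicit.
Unset Printing Implicit Defensive.

Import Order.TTheory GRing.Theory Num.Theory.
Import numFieldNormedType.Exports.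
Local Open Scope classical_set_scope.
Local Open Scope ring_scope.

(** Put s = 2 ^ gamma and b = 2 ^ (5/2). In the variables Y_n = s ^ n X_n / K
    the inviscid equations read
      Y_n' = c_n (kappa Y_(n-1)^2 - Y_n Y_(n+1)),   c_(n+1) = mu c_n,
    with kappa = s^3 / b and mu = b / s. For gamma = 1/2 these are 1/2 and 4,
    and for gamma slightly above 1/2 they are close to these values.

    A uniform bound. The bound Y_n <= 1 alone is not preserved: at
    Y_(n-1) = Y_n = 1 the component Y_n grows unless Y_(n+1) is already at least
    about 1/2. But Y_(n+1)
    evolves about four times faster than Y_n, so it cannot stay small while Y_n
    is large. Quantitatively, the region
      0 <= Y_n <= 1,   (3/4) Y_n^2 - 1/5 <= Y_(n+1) <= 3/5 + Y_n / 2
    for all n is invariant, because the vector field points strictly inwards on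
    each of its faces ([lower_face], [upper_face], [right_face]). The upper
    constraint limits Y_(n+2), which drains Y_(n+1), on the lower face. The
    region contains every sequence with values in [0, 1/2], and any datum with
    s ^ n x_n bounded becomes one after a choice of K. The argument is run on
    finite systems closed by Y_(N+1) = Y_N, a relation compatible with the
    constraints ([truncated_system_in_region]); their solutions come from
    Picard iteration ([picard]) for a right-hand side made globally Lipschitz
    by truncating values to [0, 1].

    Stability. The difference Z of two non-negative solutions is measured by
    psi_N = sum_(1 <= n <= N) 2 ^ -n Z_n^2. The weights are chosen so that the
    cross terms Z_n Z_(n+1) telescope; what remains is a non-positive sum and a
    flux through the mode N ([energy_difference]). Under the bound
    X_n <= K s ^ -n the flux is at most K^3 (b / (2 s^3)) ^ N, and b < 2 s^3
    says exactly gamma > 1/2. Hence the truncations form a Cauchy sequence,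
    whose limit is the solution ([inviscid_exists]), and two bounded solutions
    with the same datum coincide ([inviscid_unique]).

    Vanishing viscosity. For a viscous solution V compared with X, the
    inequality V_n (X_n - V_n) <= X_n^2 / 4 bounds the contribution of the
    viscous term to psi_N' by (nu / 2) sum_n 2 ^ n X_n^2, which is O(nu) because
    s^2 > 2. The flux through the
    mode N contains V, but is a vanishing factor times 1 + sum_n 4 ^ n V_n^2,
    and the dissipative part of the energy equation of V absorbs it. This gives
    |V_n(t) - X_n(t)|^2 <= C_n nu t ([viscous_stability]). *)

(** * Derivatives on the half line *)

Section HalfLineDerivative.
Variable R : realType.
Implicit Types (f g : R -> R) (t s l m c e a b d T K M : R).

Local Notation D := (@has_derivative_nneg R).

(** The quotient form of the definition is singular at the base point; in this
    form the point s = t needs no separate treatment. *)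
Lemma nderivP f t l : D f t l <->
  forall e : R, 0 < e -> exists2 d : R, 0 < d &
    forall s, 0 <= s -> `|s - t| < d -> `|f s - f t - l * (s - t)| <= e * `|s - t|.
Proof.
split.
  move=> /cvgrPdist_le h e /h; rewrite near_withinE => -[d /= d0 {}h].
  exists d => // s s0 std; have [->|st] := eqVneq s t.
    by rewrite !subrr mulr0 subrr normr0 mulr0.
  have := h s; rewrite /ball_/= distrC => /(_ std st).
  rewrite in_itv/= andbT => /(_ s0) {}h.
  have st0 : s - t != 0 by rewrite subr_eq0.
  have -> : f s - f t - l * (s - t) = - ((l - (f s - f t) / (s - t)) * (s - t)).
    by field.
  by rewrite normrN normrM ler_wpM2r.
move=> h; apply/cvgrPdist_le => e /h [d d0 {}h]; rewrite near_withinE.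
exists d => //= s; rewrite /ball_/= distrC => std st.
rewrite in_itv/= andbT => s0.
have st0 : s - t != 0 by rewrite subr_eq0.
have := h s s0 std.
have -> : f s - f t - l * (s - t) = - ((l - (f s - f t) / (s - t)) * (s - t)).
  by field.
by rewrite normrN normrM ler_pM2r ?normr_gt0.
Qed.

#[local] Instance nneg_dnbhs_filter t : Filter (within `[0, +oo[%classic t^').
Proof. exact: within_filter. Qed.

Lemma nderiv_continuous f t l : D f t l ->
  f s @[s --> within `[0, +oo[ t^'] --> f t.
Proof.
move=> h.
have h1 : s @[s --> within `[0, +oo[ t^'] --> t.
  move=> A At; have At' := nbhs_dnbhs At.
  by move: At'; apply: filterS => x Ax _; exact: Ax.
have h2 : (s - t) @[s --> within `[0, +oo[ t^'] --> t - t.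
  by exact: cvgB h1 (cvg_cst t).
have h3 := cvgD (cvg_cst (f t)) (cvgM h h2).
specialize (h3 _ _ _); rewrite subrr mulr0 addr0 in h3.
refine (cvg_trans _ h3).
apply: (@near_eq_cvg _ _ (within `[0, +oo[ t^')); rewrite near_withinE.
near=> s => _ /=; rewrite fctE/=.
have st : s != t by near: s; exact: nbhs_dnbhs_neq.
by rewrite divfK ?subr_eq0// addrC subrK.
Unshelve. all: by end_near. Qed.

Lemma nderiv_lipschitz f t l : D f t l -> exists2 d : R, 0 < d &
  forall s, 0 <= s -> `|s - t| < d -> `|f s - f t| <= (`|l| + 1) * `|s - t|.
Proof.
move=> /nderivP /(_ 1 ltr01) [d d0 h]; exists d => // s s0 std.
have := h s s0 std; have := ler_normD (f s - f t - l * (s - t)) (l * (s - t)).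
rewrite subrK normrM; lra.
Qed.

Lemma nderiv_within_continuous f (f' : R -> R) : (forall t, 0 <= t -> D f t (f' t)) ->
  {within `[0, +oo[, continuous f}.
Proof.
move=> h; apply/subspace_continuousP => t.
rewrite /= in_itv/= andbT => t0; have [d d0 {}h] := nderiv_lipschitz (h t t0).
have l0 : 0 < `|f' t| + 1 by rewrite ltr_wpDl.
apply/cvgrPdist_le => e e0; rewrite near_withinE.
exists (Num.min d (e / (`|f' t| + 1))); first by rewrite /= lt_min d0 divr_gt0.
move=> s /=; rewrite lt_min distrC => /andP[sd se].
rewrite in_itv/= andbT => s0; rewrite distrC (le_trans (h s s0 sd))//.
by rewrite mulrC -ler_pdivlMr// ltW.
Qed.

Lemma nderiv_ext f g t l : 0 <= t -> (forall s, 0 <= s -> f s = g s) -> D f t l -> D g t l.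
Proof.
move=> t0 fg /nderivP h; apply/nderivP => e /h[d d0 {}h]; exists d => // s s0 sd.
by rewrite -!fg//; exact: h.
Qed.

Lemma nderiv_cst c t : D (fun=> c) t 0.
Proof.
by apply/nderivP => e e0; exists 1 => // s _ _; rewrite !subrr mul0r subrr normr0 mulr_ge0 // ltW.
Qed.

Lemma nderiv_id t : D id t 1.
Proof.
apply/nderivP => e e0; exists 1 => // s _ _.
by rewrite mul1r subrr normr0 mulr_ge0 // ltW.
Qed.

Lemma nderivD f g t l m : D f t l -> D g t m -> D (fun s => f s + g s) t (l + m).
Proof.
move=> hf hg; refine (cvg_trans _ (cvgD hf hg)).
apply: (@near_eq_cvg _ _ (within `[0, +oo[ t^')); near=> s; rewrite fctE/=; lra.
Unshelve. all: by end_near. Qed.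

Lemma nderivM f g t l m : D f t l -> D g t m ->
  D (fun s => f s * g s) t (l * g t + f t * m).
Proof.
move=> hf hg; refine (cvg_trans _ (cvgD (cvgM hf (nderiv_continuous hg)) (cvgM (cvg_cst (f t)) hg))).
apply: (@near_eq_cvg _ _ (within `[0, +oo[ t^')); near=> s; rewrite !fctE/=; ring.
Unshelve. all: by end_near. Qed.

Lemma nderivZ c f t l : D f t l -> D (fun s => c * f s) t (c * l).
Proof. by move=> /(nderivM (@nderiv_cst c t)); rewrite mul0r add0r. Qed.

Lemma nderivN f t l : D f t l -> D (fun s => - f s) t (- l).
Proof.
move=> /(@nderivZ (-1) _ _ _); rewrite mulN1r => h.
by have <- : (fun s => -1 * f s) = (fun s => - f s) by apply/funext=> s; rewrite mulN1r.
Qed.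

Lemma nderivB f g t l m : D f t l -> D g t m -> D (fun s => f s - g s) t (l - m).
Proof. by move=> hf hg; exact: nderivD hf (nderivN hg). Qed.

Lemma nderiv_sum (I : eqType) (r : seq I) (f : I -> R -> R) (f' : I -> R) t :
  (forall i, i \in r -> D (f i) t (f' i)) ->
  D (fun s => \sum_(i <- r) f i s) t (\sum_(i <- r) f' i).
Proof.
elim: r => [|i r ih] h.
  rewrite big_nil; have -> : (fun s => \sum_(i <- [::]) f i s) = (fun=> 0).
    by apply/funext => s; rewrite big_nil.
  exact: nderiv_cst.
rewrite big_cons.
have -> : (fun s => \sum_(j <- i :: r) f j s) = (fun s => f i s + \sum_(j <- r) f j s).
  by apply/funext => s; rewrite big_cons.
apply: nderivD; first by apply: h; rewrite mem_head.
by apply: ih => j jr; apply: h; rewrite inE jr orbT.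
Qed.

Lemma is_derive_nderiv f t l : is_derive t 1 f l -> D f t l.
Proof.
move=> h; apply/nderivP => e e0.
have : h^-1 *: (f (h *: 1 + t) - f t) @[h --> 0^'] --> l.
  by have [hd <-] := h; exact: hd.
move=> /cvgrPdist_le /(_ _ e0) [d /= d0 hh]; exists d => // s s0 sd.
have [->|st] := eqVneq s t; first by rewrite !subrr mulr0 subrr normr0 mulr0.
have st0 : s - t != 0 by rewrite subr_eq0.
have := hh (s - t); rewrite /ball_/= sub0r normrN => /(_ sd st0).
rewrite /GRing.scale/= mulr1 subrK.
have -> : f s - f t - l * (s - t) = - ((l - (s - t)^-1 * (f s - f t)) * (s - t)).
  by field.
by rewrite normrN normrM => ?; rewrite ler_wpM2r.
Qed.

(** First exit argument. As long as all functions are non-negative, each of them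
    either is positive or has a positive derivative, so that no first time exists
    after which non-negativity fails. All the comparison principles below are
    instances of this lemma. *)
Lemma barrier (I : finType) (f f' : I -> R -> R) a b :
  0 <= a -> 
  (forall i t, a <= t <= b -> D (f i) t (f' i t)) ->
  (forall i, 0 <= f i a) ->
  (forall t, a <= t <= b -> (forall j, 0 <= f j t) ->
     forall i, f i t = 0 -> 0 < f' i t) ->
  forall i t, a <= t <= b -> 0 <= f i t.
Proof.
move=> a0 df fa H.
pose S := [set t | a <= t <= b /\ forall r, a <= r <= t -> forall j, 0 <= f j r].
suff Sb : forall t, a <= t <= b -> S t.
  by move=> i t /[dup]/Sb[_ h] /andP[at_ tb]; apply: h; rewrite at_ lexx.
move=> t0 /andP[at0 t0b].
have ab : a <= b by exact: le_trans t0b.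
have Sa : S a.
  split; first by rewrite lexx.
  by move=> r; rewrite -eq_le => /eqP <-.
have supS : has_sup S by split; [exists a|exists b => x [/andP[]]].
pose T := sup S.
have aT : a <= T by exact: sup_upper_bound.
have Tb : T <= b by apply: ge_sup => [|x [/andP[]]//]; exists a.
have below r : a <= r < T -> forall j, 0 <= f j r.
  move=> /andP[ar rT]; have [x Sx rx] := sup_adherent (eqbRL (subr_gt0 _ _) rT) supS.
  rewrite opprB addrC subrK in rx.
  by case: Sx => _; apply; rewrite ar ltW.
have atT j : 0 <= f j T.
  rewrite leNgt; apply/negP => fT.
  have aT' : a < T.
    by rewrite lt_neqAle aT andbT; apply/eqP => aeq; have := fa j; rewrite leNgt aeq fT.
  have TI : a <= T <= b by rewrite aT.
  have [d d0 h] := nderiv_lipschitz (df j T TI).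
  have l0 : 0 < `|f' j T| + 1 by rewrite ltr_wpDl.
  pose e := Num.min (d / 2) (Num.min (- f j T / (`|f' j T| + 1) / 2) (T - a)).
  have e0 : 0 < e.
    by rewrite /e !lt_min !divr_gt0//= ?subr_gt0 ?oppr_gt0.
  have ed : e <= d / 2 by rewrite /e ge_min lexx.
  have ef : e <= - f j T / (`|f' j T| + 1) / 2 by rewrite /e !ge_min lexx orbT.
  have ea : e <= T - a by rewrite /e !ge_min lexx !orbT.
  have Te0 : 0 <= T - e by lra.
  have := h (T - e) Te0; have -> : T - e - T = - e by ring.
  rewrite normrN gtr0_norm// => /(_ _) h'.
  have {}h' := h' ltac:(lra).
  have fe : 0 <= f j (T - e) by apply: below; lra.
  have : f j (T - e) - f j T <= (`|f' j T| + 1) * e by apply: le_trans h'; exact: ler_norm.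
  have : (`|f' j T| + 1) * e <= - f j T / 2.
    by rewrite mulrC -ler_pdivlMr//; apply: le_trans ef _; rewrite mulrAC.
  lra.
have ST : S T.
  split; first by rewrite aT.
  move=> r /andP[ar]; rewrite le_eqVlt => /orP[/eqP-> //|rT].
  by apply: below; rewrite ar.
have [Tt0|] := ltP T t0; last first.
  move=> t0T; split; first by rewrite at0.
  move=> r /andP[ar rt]; apply: ST.2; rewrite ar; exact: le_trans t0T.
exfalso.
have TI : a <= T <= b by rewrite aT.
(* Right after T each function is non-negative: by continuity if it is
   positive at T, and by the sign of its derivative if it vanishes. *)
have near_i i : \forall s \near T^'+, 0 <= f i s.
  have [d d0 h] := nderiv_lipschitz (df i T TI).
  have [fT0|fTn] := eqVneq (f i T) 0; last first.
    have fT : 0 < f i T by rewrite lt_neqAle eq_sym fTn atT.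
    have l0 : 0 < `|f' i T| + 1 by rewrite ltr_wpDl.
    exists (Num.min d (f i T / (`|f' i T| + 1))); first by rewrite /= lt_min d0 divr_gt0.
    move=> s /=; rewrite lt_min distrC => /andP[sd se] Ts.
    have := h s ltac:(lra) sd.
    have : (`|f' i T| + 1) * `|s - T| <= f i T.
      by rewrite mulrC -ler_pdivlMr// ltW.
    have := ler_norm (f i T - f i s); rewrite [in X in X -> _]distrC; lra.
  have f'0 := H T TI atT i fT0.
  have /nderivP /(_ _ f'0) [d' d'0 h'] := df i T TI.
  exists d' => // s /=; rewrite distrC => sd Ts.
  have := h' s ltac:(lra) sd; rewrite fT0 subr0 (gtr0_norm (_ : 0 < s - T)) ?subr_gt0//.
  have := ler_norm (- (f i s - f' i T * (s - T))); rewrite normrN; lra.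
have : \forall s \near T^'+, forall i, 0 <= f i s by exact: filter_forall.
move=> [d /= d0 hd].
pose s := Num.min t0 (T + d / 2).
have Ts : T < s by rewrite /s lt_min Tt0 ltrDl divr_gt0.
have st0 : s <= t0 by rewrite /s ge_min lexx.
have sd : s <= T + d / 2 by rewrite /s ge_min lexx orbT.
suff Ss : S s by have := sup_upper_bound supS Ss; rewrite leNgt Ts.
split; first by apply/andP; split; lra.
move=> r /andP[ar rs] j; have [rT|Tr] := leP r T.
  by apply: ST.2; rewrite ar.
apply: hd => //=; rewrite ltr0_norm ?subr_lt0//; lra.
Qed.

(** The mean value inequality, from [barrier] applied to the difference of the
    increments plus a small multiple of t - a, which makes the sign of the
    derivative strict. *)
Lemma le_increment f f' g g' a b : 0 <= a -> a <= b ->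
  (forall t, a <= t <= b -> D f t (f' t)) ->
  (forall t, a <= t <= b -> D g t (g' t)) ->
  (forall t, a <= t <= b -> f' t <= g' t) ->
  f b - f a <= g b - g a.
Proof.
move=> a0 ab df dg fg; apply/ler_addgt0Pr => e e0.
pose d := e / (b - a + 1).
have ba1 : 0 < b - a + 1 by lra.
have d0 : 0 < d by rewrite divr_gt0.
have := @barrier unit (fun _ t => g t - g a - (f t - f a) + d * (t - a))
  (fun _ t => g' t - 0 - (f' t - 0) + d * (1 - 0)) a b a0.
move=> /(_ _ _ _ tt b) H.
have db : d * (b - a) <= e.
  by clear H; rewrite /d mulrAC ler_pdivrMr// ler_pM2l//; lra.
suff H' : 0 <= g b - g a - (f b - f a) + d * (b - a) by clear H; lra.
apply: H; last by rewrite ab lexx.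
- move=> _ t tab /=. apply: nderivD.
    apply: nderivB; apply: nderivB; [exact: dg| exact: nderiv_cst|exact: df|exact: nderiv_cst].
  by apply: nderivZ; apply: nderivB; [exact: nderiv_id|exact: nderiv_cst].
- by move=> _; rewrite !subrr mulr0 addr0.
- by move=> t tab _ _ _; have := fg t tab; lra.
Qed.

Lemma norm_increment f f' g g' a b : 0 <= a -> a <= b ->
  (forall t, a <= t <= b -> D f t (f' t)) ->
  (forall t, a <= t <= b -> D g t (g' t)) ->
  (forall t, a <= t <= b -> `|f' t| <= g' t) ->
  `|f b - f a| <= g b - g a.
Proof.
move=> a0 ab df dg fg; rewrite ler_norml; apply/andP; split; last first.
  apply: (le_increment a0 ab df dg) => t /fg; rewrite ler_norml => /andP[]//.
rewrite lerNl opprB.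
have := le_increment a0 ab (fun t h => nderivN (df t h)) dg.
rewrite opprK [X in _ -> X <= _]addrC; apply => t /fg.
by rewrite ler_norml lerNl => /andP[].
Qed.

Lemma nderiv_expR c t : D (fun t => expR (c * t)) t (c * expR (c * t)).
Proof.
apply: is_derive_nderiv.
have h : is_derive t (1 : R) (fun t => expR (c * t)) (expR (c * t) * (c *: 1)).
  apply: (@is_derive1_comp _ expR (fun t => c * t)).
by apply: is_derive_eq; rewrite /GRing.scale/= mulr1 mulrC.
Qed.

(** [barrier] applied to f plus a small multiple of exp ((M + 1) t), where M
    bounds - q on [0, T]: when this sum vanishes, f is a negative multiple of the
    exponential, and the growth rate M + 1 beats the term q f. *)
Lemma ge0_linear_ode f p q T : 0 <= T ->
  (forall t, 0 <= t <= T -> D f t (p t - q t * f t)) ->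
  (forall t, 0 <= t <= T -> 0 <= p t) ->
  {within `[0, T], continuous q} ->
  0 <= f 0 -> 0 <= f T.
Proof.
move=> T0 df p0 cq f0.
have cNq : {within `[0, T], continuous (fun t => - q t)}.
  by move=> t; apply: cvgN; exact: cq.
have [tM _ qM] := EVT_max T0 cNq.
set M := - q tM in qM.
have {}qM t : 0 <= t <= T -> - q t <= M.
  by move=> tT; apply: qM; rewrite in_itv.
clearbody M.
apply/ler_addgt0Pr => e e0.
pose d := e / expR ((M + 1) * T).
have d0 : 0 < d by rewrite divr_gt0// expR_gt0.
have := @barrier unit (fun _ t => f t + d * expR ((M + 1) * t))
  (fun _ t => p t - q t * f t + d * ((M + 1) * expR ((M + 1) * t))) 0 T (lexx _).
move=> /(_ _ _ _ tt T); rewrite /d divfK ?gt_eqF ?expR_gt0//; apply.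
- move=> _ t tT /=; apply: nderivD; first exact: df.
  by apply: nderivZ; exact: nderiv_expR.
- by move=> _; rewrite addr_ge0// mulr_ge0 ?expR_ge0// ltW.
- move=> t tT _ _ /eqP; rewrite addr_eq0 -/d => /eqP ->.
  rewrite mulrN opprK -addrA ltr_wpDl ?p0//.
  have := expR_gt0 ((M + 1) * t); move: (expR _) => E E0.
  have -> : q t * (d * E) + d * ((M + 1) * E) = (q t + M + 1) * (d * E) by ring.
  have qM1 : 0 < q t + M + 1 by have := qM t tT; clear; lra.
  by apply: mulr_gt0; [exact: qM1|apply: mulr_gt0; [exact: d0|exact: E0]].
- by rewrite T0 lexx.
Qed.

Lemma nderiv_linear c t : D (fun x => c * x) t c.
Proof. by have := @nderivZ c _ _ _ (@nderiv_id t); rewrite mulr1. Qed.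

(** Uniform convergence on each [0, T]. *)
Definition loc_unif_cvg (u : nat -> R -> R) f := forall T e, 0 < e ->
  exists k0 : nat, forall k, (k0 <= k)%N -> forall t, 0 <= t <= T ->
    `|u k t - f t| <= e.

Lemma loc_unif_cauchy (u : nat -> R -> R) :
  (forall T e, 0 < e ->
  exists k0 : nat, forall j k, (k0 <= j)%N -> (k0 <= k)%N -> forall t, 0 <= t <= T ->
    `|u j t - u k t| <= e) -> exists f, loc_unif_cvg u f.
Proof.
move=> h; exists (fun t => lim (u k t @[k --> \oo])).
move=> T e e0; have [k0 hk] := h T e e0; exists k0 => k kk t tT.
have cv : cvg (u k t @[k --> \oo]).
  apply/cauchy_cvgP; apply/cauchy_exP => d d0.
  have [k1 hk1] := h T (d / 2) (divr_gt0 d0 (ltr0n _ 2)).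
  exists (u k1 t); exists k1 => // j /= kj; rewrite /ball/=.
  apply: le_lt_trans (hk1 k1 j (leqnn _) kj t tT) _.
  by rewrite ltr_pdivrMr// ltr_pMr// ltr1n.
have cvd : (u k t - u j t) @[j --> \oo] --> u k t - lim (u k t @[k --> \oo]).
  by apply: cvgB => //; exact: cvg_cst.
have <- := cvg_lim (@Rhausdorff R) (cvg_norm cvd).
apply: limr_le; first by apply/cvg_ex; eexists; exact: cvg_norm cvd.
by exists k0 => // j kj; exact: hk.
Qed.

Lemma loc_unifZ c u f : loc_unif_cvg u f -> loc_unif_cvg (fun k t => c * u k t) (fun t => c * f t).
Proof.
move=> uf T e e0.
have c0 : 0 < `|c| + 1 by rewrite ltr_wpDl.
have [k0 h] := uf T (e / (`|c| + 1)) (divr_gt0 e0 c0).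
exists k0 => k kk t tT; rewrite -mulrBr normrM.
have := h k kk t tT; rewrite ler_pdivlMr// => h1.
by apply: le_trans h1; rewrite mulrC ler_wpM2l// lerDl.
Qed.

Lemma loc_unifB u f v g : loc_unif_cvg u f -> loc_unif_cvg v g ->
  loc_unif_cvg (fun k t => u k t - v k t) (fun t => f t - g t).
Proof.
move=> uf vg T e e0.
have e2 : 0 < e / 2 by lra.
have [k1 h1] := uf T _ e2; have [k2 h2] := vg T _ e2.
exists (maxn k1 k2) => k; rewrite geq_max => /andP[/h1 {}h1 /h2 {}h2] t tT.
have := h1 t tT; have := h2 t tT.
have -> : u k t - v k t - (f t - g t) = (u k t - f t) - (v k t - g t) by ring.
have := ler_normB (u k t - f t) (v k t - g t).
clear; lra.
Qed.

Lemma loc_unifM u f v g K : 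
  (forall k t, 0 <= t -> `|v k t| <= K) ->
  (forall t, 0 <= t -> `|f t| <= K) ->
  loc_unif_cvg u f -> loc_unif_cvg v g ->
  loc_unif_cvg (fun k t => u k t * v k t) (fun t => f t * g t).
Proof.
move=> bf bg uf vg T e e0.
have K0 : 0 <= K by apply: le_trans (bg 0 (lexx _)).
have K1 : 0 < 2 * (K + 1) by clear -K0; lra.
have [k1 h1] := uf T _ (divr_gt0 e0 K1); have [k2 h2] := vg T _ (divr_gt0 e0 K1).
exists (maxn k1 k2) => k; rewrite geq_max => /andP[/h1 {}h1 /h2 {}h2] t tT.
have t0 : 0 <= t by case/andP: tT.
have := h1 t tT; have := h2 t tT; rewrite !ler_pdivlMr//.
have -> : u k t * v k t - f t * g t = (u k t - f t) * v k t + (v k t - g t) * f t by ring.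
move=> h3 h4; apply: le_trans (ler_normD _ _) _; rewrite !normrM.
have h5 := ler_wpM2l (normr_ge0 (u k t - f t)) (bf k t t0).
have h6 := ler_wpM2l (normr_ge0 (v k t - g t)) (bg t t0).
have := normr_ge0 (u k t - f t); have := normr_ge0 (v k t - g t).
clear -h3 h4 h5 h6; lra.
Qed.

(** Termwise differentiation. The difference quotients of u_j - u_k at t are
    bounded by the supremum of |g_j - g_k|; letting j tend to infinity bounds
    those of f - u_k. *)
Lemma loc_unif_nderiv (u g : nat -> R -> R) f h :
  (forall k t, 0 <= t -> D (u k) t (g k t)) ->
  loc_unif_cvg u f -> loc_unif_cvg g h ->
  forall t, 0 <= t -> D f t (h t).
Proof.
move=> du uf gh t t0; apply/nderivP => e e0.
have e4 : 0 < e / 4 by lra.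
have [k hk] := gh (t + 1) (e / 4) e4.
have [d d0 dk] := (nderivP _ _ _).1 (du k t t0) (e / 4) e4.
have inc j : (k <= j)%N -> forall a b, 0 <= a -> a <= b -> b <= t + 1 ->
    `|(u j b - u k b) - (u j a - u k a)| <= e / 2 * (b - a).
  move=> kj a b a0 ab bt.
  have cmp x : a <= x <= b -> `|g j x - g k x| <= e / 2.
    move=> xab; have x01 : 0 <= x <= t + 1 by lra.
    have := hk j kj x x01; have := hk k (leqnn _) x x01.
    have := ler_normB (g j x - h x) (g k x - h x).
    have -> : g j x - h x - (g k x - h x) = g j x - g k x by ring.
    clear; lra.
  have dd x : a <= x <= b -> D (fun x => u j x - u k x) x (g j x - g k x).
    by move=> xab; apply: nderivB; apply: du; lra.
  have de x : a <= x <= b -> D (fun x => e / 2 * x) x (e / 2).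
    by move=> _; exact: nderiv_linear.
  by rewrite mulrBr; exact: norm_increment dd de cmp.
have inc' j : (k <= j)%N -> forall s, 0 <= s -> s <= t + 1 ->
    `|(u j s - u k s) - (u j t - u k t)| <= e / 2 * `|s - t|.
  move=> kj s s0 st1; have [st|ts] := leP s t.
    by rewrite distrC [`|s - t|]distrC (ger0_norm (_ : 0 <= t - s)) ?subr_ge0//; apply: inc => //; lra.
  by rewrite (gtr0_norm (_ : 0 < s - t)) ?subr_gt0//; apply: inc => //; lra.
have incf s : 0 <= s -> s <= t + 1 ->
    `|(f s - u k s) - (f t - u k t)| <= e / 2 * `|s - t|.
  move=> s0 st1; apply/ler_addgt0Pr => z z0.
  have z2 : 0 < z / 2 by lra.
  have [j0 hj] := uf (t + 1) _ z2.
  pose j := maxn j0 k.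
  have := inc' j (leq_maxr _ _) s s0 st1.
  have := hj j (leq_maxl _ _) s; rewrite s0 st1 => /(_ isT).
  have := hj j (leq_maxl _ _) t; rewrite t0 lerDl ler01 => /(_ isT).
  have -> : (f s - u k s) - (f t - u k t) = ((u j s - u k s) - (u j t - u k t)) -
     ((u j s - f s) - (u j t - f t)) by ring.
  have := ler_normB ((u j s - u k s) - (u j t - u k t)) ((u j s - f s) - (u j t - f t)).
  have := ler_normB (u j s - f s) (u j t - f t).
  clear; lra.
exists (Num.min d 1); first by rewrite lt_min d0 ltr01.
move=> s s0; rewrite lt_min => /andP[sd s1].
have st1 : s <= t + 1 by have := ler_norm (s - t); lra.
have h1 := incf s s0 st1.
have h2 := dk s s0 sd.
have h3 := hk k (leqnn _) t; rewrite t0 lerDl ler01 in h3.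
have {}h3 := ler_wpM2r (normr_ge0 (s - t)) (h3 isT).
rewrite -normrM in h3.
have -> : f s - f t - h t * (s - t) = (f s - u k s) - (f t - u k t) +
   ((u k s - u k t - g k t * (s - t)) + (g k t - h t) * (s - t)) by ring.
apply: le_trans (ler_normD _ _) _.
have := ler_normD (u k s - u k t - g k t * (s - t)) ((g k t - h t) * (s - t)).
clear -h1 h2 h3; lra.
Qed.

(** The function is extended by its value at 0 and integrated from -1, so that
    0 becomes an interior point and the two-sided fundamental theorem of calculus
    applies there. *)
Lemma primitive g C : (forall s t, 0 <= s -> 0 <= t -> `|g s - g t| <= C * `|s - t|) ->
  exists G : R -> R, G 0 = 0 /\ forall t, 0 <= t -> D G t (g t).
Proof.
move=> lip; pose h t := g (Num.max 0 t).
have C0 : 0 <= C by have := lip 1 0; rewrite ler01 lexx subr0 normr1 mulr1 => /(_ isT isT); exact: le_trans.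
have hlip s t : `|h s - h t| <= C * `|s - t|.
  rewrite /h; apply: le_trans (lip _ _ _ _) _; rewrite ?le_max ?lexx//.
  apply: ler_wpM2l => //.
  rewrite !maxEle; case: (leP 0 s) => s0; case: (leP 0 t) => t0 //; rewrite ?subrr ?subr0 ?normr0 ?sub0r//.
  - by rewrite !ger0_norm//; lra.
  - by rewrite normrN ger0_norm// ler0_norm; lra.
have hc : continuous h.
  move=> t; apply/cvgrPdist_le => e e0.
  exists (e / (C + 1)) => /=; first by rewrite divr_gt0// ltr_wpDl.
  move=> s /= ts; apply: le_trans (hlip _ _) _.
  have : `|t - s| * (C + 1) <= e by rewrite -ler_pdivlMr ?ltr_wpDl// ltW.
  have := normr_ge0 (t - s); clear; lra.
pose mu := @lebesgue_measure R.
pose F t : R := (\int[mu]_(x in `[-1, t]) h x)%R.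
exists (fun t => F t - F 0); split; first by rewrite subrr.
move=> t t0; have -> : g t = g t - 0 by rewrite subr0.
apply: nderivB; last exact: nderiv_cst.
apply: is_derive_nderiv.
have [||||dF eF] := @continuous_FTC1_closed R h (-1) t (t + 1).
- by rewrite ltrDl.
- apply: continuous_compact_integrable; first exact: segment_compact.
  exact: continuous_subspaceT.
- by lra.
- exact: hc.
rewrite derive1E in eF.
have <- : h t = g t by rewrite /h max_r.
rewrite -eF; exact: (@DeriveDef _ _ _ _ _ _ _ dF erefl).
Qed.

End HalfLineDerivative.

(** * Picard iteration *)

Section Picard.
Variable R : realType.
Implicit Types (t s e a b d T K M : R).

Local Notation D := (@has_derivative_nneg R).

Lemma geometric_small (C r e : R) : 0 <= r -> r < 1 -> 0 < e ->
  exists k0, forall k, (k0 <= k)%N -> C * r ^+ k <= e.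
Proof.
move=> r0 r1 e0.
have C0 : 0 < `|C| + 1 by rewrite ltr_wpDl.
have := @cvg_expr R r; rewrite ger0_norm// => /(_ r1) /cvgrPdist_le.
move=> /(_ _ (divr_gt0 e0 C0)) [k0 _ h]; exists k0 => k kk.
have := h k kk; rewrite /= sub0r normrN ger0_norm ?exprn_ge0// ler_pdivlMr//.
have := ler_wpM2r (exprn_ge0 k r0) (ler_norm C).
have := exprn_ge0 k r0; lra.
Qed.

(** F is Lipschitz for the sup distance on sequences. The iterates are
    B-Lipschitz in time uniformly in n, which makes F along an iterate Lipschitz
    in time as well, hence integrable. In the time weight exp (2 L t) each
    iteration halves the distance, so the convergence is global in time. *)
Lemma picard (F : (nat -> R) -> nat -> R) (B L : R) (x0 : nat -> R) :
  0 <= B -> 1 <= L ->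
  (forall u n, `|F u n| <= B) ->
  (forall u v e n, (forall k, `|u k - v k| <= e) -> `|F u n - F v n| <= L * e) ->
  exists X : nat -> R -> R, (forall n, X n 0 = x0 n) /\
    forall n t, 0 <= t -> D (X n) t (F (fun k => X k t) n).
Proof.
move=> B0 L1 FB FL.
pose curve (W : nat -> R -> R) := forall n s t, 0 <= s -> 0 <= t ->
  `|W n s - W n t| <= B * `|s - t|.
pose step (W W' : nat -> R -> R) := (forall n, W' n 0 = x0 n) /\
  forall n t, 0 <= t -> D (W' n) t (F (fun k => W k t) n).
have ex_step W : exists W', curve W -> step W W'.
  have [cW|ncW] := pselect (curve W); last by exists W.
  have prim n : exists G : R -> R, G 0 = 0 /\
      forall t, 0 <= t -> D G t (F (fun k => W k t) n).
    apply: (@primitive R _ (L * B)) => s t s0 t0; rewrite -mulrA.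
    by apply: FL => k; exact: cW.
  have [G hG] := choice prim.
  exists (fun n t => x0 n + G n t) => _; split=> n; first by rewrite (hG n).1 addr0.
  move=> t t0; have := nderivD (@nderiv_cst R (x0 n) t) ((hG n).2 t t0).
  by rewrite add0r.
have step_curve W W' : step W W' -> curve W'.
  move=> [_ dW]; suff h n s t : 0 <= s -> s <= t -> `|W' n t - W' n s| <= B * (t - s).
    move=> n s t s0 t0; have [st|ts] := leP s t.
      by rewrite distrC [`|s - t|]distrC (ger0_norm (_ : 0 <= t - s)) ?subr_ge0// h.
    by rewrite (gtr0_norm (_ : 0 < s - t)) ?subr_gt0// h// ltW.
  move=> s0 st; rewrite mulrBr.
  apply: (norm_increment s0 st) (fun t _ => @nderiv_linear R B t) _.
    by move=> r /andP[sr _]; apply: dW; exact: le_trans sr.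
  by move=> r _; exact: FB.
have [next hnext] := choice ex_step.
pose U k := iter k next (fun n _ => x0 n).
have Ucurve k : curve (U k).
  elim: k => [|k ih]; last exact: step_curve (hnext _ ih).
  by move=> n s t s0 t0; rewrite /= subrr normr0 mulr_ge0.
have Ustep k : step (U k) (U k.+1) by exact: hnext.
have U0 k n : U k n 0 = x0 n.
  by case: k => [//|k]; have [] := Ustep k.
pose E t := expR (2 * L * t).
have E0 t : 0 < E t by exact: expR_gt0.
pose h : R := 2^-1.
have h01 : 0 <= h < 1 by rewrite /h; lra.
have [h0 h1] := andP h01.
have inc k n t : 0 <= t -> `|U k.+1 n t - U k n t| <= B * h ^+ k * E t.
  elim: k n t => [|k ih] n t t0.
    rewrite expr0 mulr1.
    have Bt : B * t <= B * E t.
      apply: ler_wpM2l => //; apply: le_trans (expR_ge1Dx _).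
      have : t <= L * t by rewrite ler_peMl.
      by lra.
    apply: le_trans Bt; have := Ucurve 1%N n t 0 t0 (lexx _).
    by rewrite (U0 1%N) subr0 (ger0_norm t0).
  have dif s : 0 <= s <= t -> D (fun s => U k.+2 n s - U k.+1 n s) s
     (F (fun j => U k.+1 j s) n - F (fun j => U k j s) n).
    by move=> /andP[s0 _]; apply: nderivB; [apply: (Ustep k.+1).2|apply: (Ustep k).2].
  have dE s : 0 <= s <= t -> D (fun s => B * h ^+ k.+1 * E s) s
      (B * h ^+ k.+1 * (2 * L * E s)).
    by move=> _; apply: nderivZ; exact: nderiv_expR.
  have := norm_increment (lexx 0) t0 dif dE.
  rewrite !U0 !subrr subr0 => H; apply: le_trans (H _) _.
    move=> s /andP[s0 _].
    have -> : B * h ^+ k.+1 * (2 * L * E s) = L * (B * h ^+ k * E s).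
      by rewrite exprS /h; field.
    by apply: FL => j; exact: ih.
  by rewrite gerBl ?mulr_ge0 ?exprn_ge0// ltW.
have telescope k m n t : 0 <= t ->
    `|U (k + m)%N n t - U k n t| <= 2 * B * (h ^+ k - h ^+ (k + m)) * E t.
  move=> t0; elim: m => [|m ih]; first by rewrite addn0 !subrr normr0 mulr0 mul0r.
  rewrite addnS.
  have := ler_normD (U (k + m)%N.+1 n t - U (k + m)%N n t) (U (k + m)%N n t - U k n t).
  rewrite addrA subrK => /le_trans; apply.
  apply: le_trans (lerD (inc _ n t t0) ih) _.
  by rewrite exprS /h le_eqVlt; apply/orP; left; apply/eqP; field.
have cauchy k j n t : (k <= j)%N -> 0 <= t ->
    `|U j n t - U k n t| <= 2 * B * h ^+ k * E t.
  move=> kj t0; rewrite -(subnKC kj); apply: le_trans (telescope _ _ _ _ t0) _.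
  apply: ler_wpM2r; first exact: ltW.
  by apply: ler_wpM2l; [rewrite mulr_ge0|rewrite gerBl exprn_ge0].
have Emono T t : 0 <= t <= T -> E t <= E T.
  move=> /andP[t0 tT]; rewrite ler_expR; apply: ler_wpM2l => //; lra.
have small (C T e : R) : 0 <= C -> 0 < e -> exists k0, forall k, (k0 <= k)%N ->
    forall t, 0 <= t <= T -> C * h ^+ k * E t <= e.
  move=> C0 e0; have [k0 hk] := @geometric_small (C * E T) h e h0 h1 e0.
  exists k0 => k kk t tT; apply: le_trans (hk k kk).
  by rewrite mulrAC ler_wpM2r ?exprn_ge0// ler_wpM2l// Emono.
have ex_lim n : exists f, loc_unif_cvg (fun k => U k n) f.
  apply: loc_unif_cauchy => T e e0.
  have BB : 0 <= 2 * B by lra.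
  have e2 : 0 < e / 2 by lra.
  have [k0 hk] := small _ T _ BB e2.
  exists k0 => i j ki kj t tT; have t0 : 0 <= t by case/andP: tT.
  have := cauchy k0 i n t ki t0; have := cauchy k0 j n t kj t0.
  have := hk k0 (leqnn _) t tT.
  have := ler_normB (U i n t - U k0 n t) (U j n t - U k0 n t).
  have -> : U i n t - U k0 n t - (U j n t - U k0 n t) = U i n t - U j n t by ring.
  lra.
have [X hX] := choice ex_lim.
have close k n t : 0 <= t -> `|U k n t - X n t| <= 2 * B * h ^+ k * E t.
  move=> t0; apply/ler_addgt0Pr => e e0.
  have [k0 hk] := hX n t e e0.
  have := hk (maxn k k0) (leq_maxr _ _) t; rewrite t0 lexx => /(_ isT).
  have := cauchy k (maxn k k0) n t (leq_maxl _ _) t0.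
  have := ler_normB (U (maxn k k0) n t - X n t) (U (maxn k k0) n t - U k n t).
  have -> : U (maxn k k0) n t - X n t - (U (maxn k k0) n t - U k n t) =
    U k n t - X n t by ring.
  lra.
exists X; split=> n.
  apply/eqP; rewrite eq_sym -subr_eq0 -normr_le0; apply/ler_addgt0Pr => e e0.
  have [k hk] := hX n 0 e e0.
  by have := hk k (leqnn _) 0; rewrite U0 lexx add0r => /(_ isT).
apply: (@loc_unif_nderiv R (fun k => U k.+1 n) (fun k t => F (fun j => U k j t) n)).
- by move=> k t t0; apply: (Ustep k).2.
- move=> T e e0; have [k0 hk] := hX n T e e0; exists k0 => k kk.
  by apply: hk; exact: leqW.
- move=> T e e0.
  have BL : 0 <= L * (2 * B) by rewrite mulr_ge0//; lra.
  have [k0 hk] := small _ T _ BL e0; exists k0 => k kk t tT.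
  apply: le_trans (hk k kk t tT); rewrite -!mulrA; apply: FL => j; rewrite !mulrA.
  by apply: close; case/andP: tT.
Qed.

End Picard.

(** * Stability of bounded inviscid solutions *)

Section Stability.
Variable R : realType.
Implicit Types (t e K beta gamma nu : R) (u v : nat -> R) (n N : nat).

Local Notation D := (@has_derivative_nneg R).

Lemma lam_powR n beta : (1 <= n)%N -> lam R n `^ beta = (2 `^ beta) ^+ n.
Proof.
case: n => // n _; rewrite /lam -powR_mulrn// -powRrM mulrC powRrM powR_mulrn// powR_ge0.
Qed.

Lemma lam0_powR beta : beta != 0 -> lam R 0 `^ beta = 0.
Proof. exact: powR0. Qed.

(** With Z = u - v and W = u + v, the nonlinear term of mode n is
    c_(n-1) Z_(n-1) W_(n-1) - c_n (Z_n W_(n+1) + W_n Z_(n+1)) / 2. After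
    multiplication by 2 ^ -n Z_n, the product Z_n Z_(n+1) W_n occurs in mode n
    with the factor - 2 ^ -n c_n / 2 and in mode n + 1 with the factor
    2 ^ -(n+1) c_n, which cancel. The terms Z_n^2 W_(n+1) have a sign, and the
    product left over in mode N is the right-hand side. *)
Lemma energy_difference beta u v N : beta != 0 ->
  (forall n, (1 <= n <= N.+1)%N -> 0 <= u n) ->
  (forall n, (1 <= n <= N.+1)%N -> 0 <= v n) ->
  \sum_(1 <= n < N.+1) 2^-1 ^+ n * (2 * ((u n - v n) *
     (inviscid_rhs beta n u - inviscid_rhs beta n v))) <=
  2^-1 ^+ N * lam R N `^ beta * ((u N ^+ 2 - v N ^+ 2) * (v N.+1 - u N.+1)).
Proof.
move=> b0; elim: N => [|N ih] u0 v0.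
  by rewrite big_geq// lam0_powR// mulr0 mul0r.
rewrite big_nat_recr//=.
have ok n : (1 <= n <= N.+1)%N -> (1 <= n <= N.+2)%N.
  by case/andP => -> /=; exact: leqW.
have {}ih := ih (fun n h => u0 n (ok n h)) (fun n h => v0 n (ok n h)).
have c0 : 0 <= lam R N.+1 `^ beta by exact: powR_ge0.
rewrite /inviscid_rhs/=; move: (u0 N.+2) (v0 N.+2) ih c0; rewrite ltnSn/=.
move: (lam R N.+1 `^ beta) (lam R N `^ beta) => c c' /(_ isT) + /(_ isT).
move: (u N) (v N) (u N.+1) (v N.+1) (u N.+2) (v N.+2) => u1 v1 u2 v2 u3 v3 u30 v30.
rewrite [2^-1 ^+ N.+1]exprS; have h0 : 0 <= (2^-1 : R) ^+ N by rewrite exprn_ge0.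
move: ((2^-1 : R) ^+ N) h0 => h h0 ih c0.
apply: le_trans (lerD ih (lexx _)) _.
rewrite -subr_ge0.
have -> : 2^-1 * h * c * ((u2 ^+ 2 - v2 ^+ 2) * (v3 - u3)) -
  (h * c' * ((u1 ^+ 2 - v1 ^+ 2) * (v2 - u2)) +
   2^-1 * h * (2 * ((u2 - v2) * (c' * u1 ^+ 2 - c * u2 * u3 - (c' * v1 ^+ 2 - c * v2 * v3))))) =
  2^-1 * h * c * ((u2 - v2) ^+ 2 * (u3 + v3)) by field.
apply: mulr_ge0; first by rewrite !mulr_ge0// invr_ge0.
by rewrite mulr_ge0 ?sqr_ge0 ?addr_ge0.
Qed.

Lemma nderiv_weighted_distance (X Y : nat -> R -> R) (X' Y' : nat -> R) N t :
  (forall n, (1 <= n <= N)%N -> D (X n) t (X' n)) ->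
  (forall n, (1 <= n <= N)%N -> D (Y n) t (Y' n)) ->
  D (fun t => \sum_(1 <= n < N.+1) 2^-1 ^+ n * (X n t - Y n t) ^+ 2) t
    (\sum_(1 <= n < N.+1) 2^-1 ^+ n * (2 * ((X n t - Y n t) * (X' n - Y' n)))).
Proof.
move=> dX dY; apply: nderiv_sum => n; rewrite mem_index_iota ltnS => nN.
apply: nderivZ.
have dXY := nderivB (dX n nN) (dY n nN).
have -> : 2 * ((X n t - Y n t) * (X' n - Y' n)) =
  (X' n - Y' n) * (X n t - Y n t) + (X n t - Y n t) * (X' n - Y' n) by ring.
exact: nderivM.
Qed.

Lemma weighted_distance_ge u v N n : (1 <= n <= N)%N ->
  2^-1 ^+ n * (u n - v n) ^+ 2 <=
  \sum_(1 <= n < N.+1) 2^-1 ^+ n * (u n - v n) ^+ 2.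
Proof.
move=> nN; rewrite (bigD1_seq n)/= ?iota_uniq ?mem_index_iota//.
by rewrite lerDl sumr_ge0// => i _; rewrite mulr_ge0 ?sqr_ge0// exprn_ge0.
Qed.

(** Both solutions need to satisfy the equations up to mode N only, so that
    truncated systems of different sizes can be compared. *)
Lemma inviscid_stability beta (s K : R) (X Y : nat -> R -> R) N :
  beta != 0 -> 1 <= s ->
  (forall n, (1 <= n <= N)%N -> forall t, 0 <= t ->
     D (X n) t (inviscid_rhs beta n (fun k => X k t))) ->
  (forall n, (1 <= n <= N)%N -> forall t, 0 <= t ->
     D (Y n) t (inviscid_rhs beta n (fun k => Y k t))) ->
  (forall n, (1 <= n <= N.+1)%N -> forall t, 0 <= t -> 0 <= X n t <= K / s ^+ n) ->
  (forall n, (1 <= n <= N.+1)%N -> forall t, 0 <= t -> 0 <= Y n t <= K / s ^+ n) ->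
  (forall n, (1 <= n <= N)%N -> X n 0 = Y n 0) ->
  forall n, (1 <= n <= N)%N -> forall t, 0 <= t ->
   (X n t - Y n t) ^+ 2 <= 2 ^+ n * (K ^+ 3 * (2 `^ beta / (2 * s ^+ 3)) ^+ N * t).
Proof.
move=> b0 s1 dX dY bX bY XY0 n nN t t0.
have s0 : 0 < s by lra.
have N1 : (1 <= N)%N by case/andP: nN => n1 /(leq_trans n1).
set r := 2 `^ beta / (2 * s ^+ 3).
have K0 : 0 <= K.
  have /andP[h1 h2] := bX 1%N isT 0 (lexx _).
  by have := le_trans h1 h2; rewrite pmulr_lge0// invr_gt0 expr1.
have bound x : 0 <= x <= t ->
    \sum_(1 <= n < N.+1) 2^-1 ^+ n * (2 * ((X n x - Y n x) *
     (inviscid_rhs beta n (fun k => X k x) - inviscid_rhs beta n (fun k => Y k x)))) <=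
    K ^+ 3 * r ^+ N.
  move=> /andP[x0 _].
  apply: le_trans (energy_difference b0 _ _) _.
  - by move=> k kN; case/andP: (bX k kN x x0).
  - by move=> k kN; case/andP: (bY k kN x x0).
  have NN : (1 <= N <= N.+1)%N by rewrite N1 leqnSn.
  have NN1 : (1 <= N.+1 <= N.+1)%N by rewrite leqnn.
  have /andP[u0 u1] := bX N NN x x0; have /andP[v0 v1] := bY N NN x x0.
  have /andP[u'0 u'1] := bX N.+1 NN1 x x0; have /andP[v'0 v'1] := bY N.+1 NN1 x x0.
  set a := K / s ^+ N in u1 v1.
  have a0 : 0 <= a by rewrite divr_ge0// exprn_ge0// ltW.
  have aa : K / s ^+ N.+1 <= a.
    rewrite ler_wpM2l// lef_pV2 ?posrE ?exprn_gt0//.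
    by rewrite exprS ler_peMl// exprn_ge0// ltW.
  rewrite lam_powR// /r [in leRHS]expr_div_n [in leRHS]exprMn -[in leRHS]exprM.
  have -> : K ^+ 3 * ((2 `^ beta) ^+ N / (2 ^+ N * s ^+ (3 * N))) =
     2^-1 ^+ N * (2 `^ beta) ^+ N * a ^+ 3.
    rewrite /a exprVn expr_div_n -exprM mulnC.
    by field; rewrite !expf_neq0 ?gt_eqF.
  apply: ler_wpM2l; first by rewrite mulr_ge0 ?exprn_ge0// powR_ge0.
  apply: le_trans (ler_norm _) _; rewrite normrM (_ : a ^+ 3 = a ^+ 2 * a); last by ring.
  have {u'1}u'1 := le_trans u'1 aa; have {v'1}v'1 := le_trans v'1 aa.
  apply: ler_pM => //; rewrite ler_norml.
    have := ler_pM u0 u0 u1 u1; have := ler_pM v0 v0 v1 v1.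
    rewrite -!expr2; have := sqr_ge0 (X N x); have := sqr_ge0 (Y N x).
    by move=> *; apply/andP; split; lra.
  by apply/andP; split; lra.
have dist_deriv x : 0 <= x <= t ->
    D (fun t => \sum_(1 <= n < N.+1) 2^-1 ^+ n * (X n t - Y n t) ^+ 2) x
    (\sum_(1 <= n < N.+1) 2^-1 ^+ n * (2 * ((X n x - Y n x) *
     (inviscid_rhs beta n (fun k => X k x) - inviscid_rhs beta n (fun k => Y k x))))).
  move=> /andP[x0 _]; apply: nderiv_weighted_distance => k kN; [exact: dX|exact: dY].
have inc := le_increment (lexx 0) t0 dist_deriv
  (fun x _ => @nderiv_linear R (K ^+ 3 * r ^+ N) x) bound.
rewrite mulr0 subr0 in inc.
have z0 : \sum_(1 <= n < N.+1) 2^-1 ^+ n * (X n 0 - Y n 0) ^+ 2 = 0.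
  by rewrite big_nat big1// => i iN; rewrite XY0// subrr expr0n mulr0.
rewrite z0 subr0 in inc.
have := le_trans (weighted_distance_ge (fun n => X n t) (fun n => Y n t) nN) inc.
by rewrite exprVn mulrC ler_pdivrMr ?exprn_gt0// mulrC.
Qed.

End Stability.

(** * Comparison of viscous and inviscid solutions *)

Section Viscous.
Variable R : realType.
Implicit Types (t e K beta gamma nu : R) (u v : nat -> R) (n N : nat).

Local Notation D := (@has_derivative_nneg R).

Lemma viscous_rhsE beta nu n u :
  viscous_rhs beta nu n u = inviscid_rhs beta n u - nu * lam R n ^+ 2 * u n.
Proof. by rewrite /viscous_rhs /inviscid_rhs; ring. Qed.

(** The inflow is a square, and the outflow and the viscosity are proportional
    to X_n, so that [ge0_linear_ode] applies to each mode separately. *)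
Lemma viscous_solution_ge0 beta nu (x : nat -> R) (X : nat -> R -> R) :
  (forall n, (1 <= n)%N -> 0 <= x n) ->
  viscous_solution beta nu x X ->
  forall n, (1 <= n)%N -> forall t, 0 <= t -> 0 <= X n t.
Proof.
move=> x0 solX n n1 t t0; have [X0 [_ dX]] := solX n n1.
apply: (@ge0_linear_ode R (X n) (fun t => lam R n.-1 `^ beta * X n.-1 t ^+ 2)
  (fun t => nu * lam R n ^+ 2 + lam R n `^ beta * X n.+1 t) t t0).
- move=> r /andP[r0 _]; have := dX r r0; rewrite /viscous_rhs; set l := (l in D _ _ l).
  by move=> h; rewrite [X in D _ _ X](_ : _ = l)// /l; ring.
- by move=> r _; rewrite mulr_ge0 ?sqr_ge0 ?powR_ge0.
- have [_ [_ dX1]] := solX n.+1 isT.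
  have c1 := nderiv_within_continuous dX1.
  have {}c1 : {within `[0, t], continuous (X n.+1)}.
    by apply: continuous_subspaceW c1 => r /=; rewrite !in_itv/= => /andP[->].
  move=> r; apply: cvgD; first exact: cvg_cst.
  by apply: cvgMr; exact: c1.
- by rewrite X0 x0.
Qed.

Lemma inviscid_is_viscous0 beta (x : nat -> R) (X : nat -> R -> R) :
  inviscid_solution beta x X -> viscous_solution beta 0 x X.
Proof.
move=> solX n n1; have [X0 dX] := solX n n1; split => //.
have -> : (fun t => viscous_rhs beta 0 n (fun k => X k t)) =
          (fun t => inviscid_rhs beta n (fun k => X k t)).
  by apply/funext => t; rewrite viscous_rhsE !mul0r subr0.
exact: dX.
Qed.

(** The energy fluxes between consecutive modes telescope. *)
Lemma energy_balance beta u N : beta != 0 ->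
  \sum_(1 <= n < N.+1) u n * inviscid_rhs beta n u =
  - (lam R N `^ beta * u N ^+ 2 * u N.+1).
Proof.
move=> b0; elim: N => [|N ih]; first by rewrite big_geq// lam0_powR// !mul0r oppr0.
by rewrite big_nat_recr//= ih /inviscid_rhs/=; ring.
Qed.

Lemma geometric_sum_le (q : R) N : 0 <= q -> q < 1 ->
  \sum_(1 <= n < N.+1) q ^+ n <= (1 - q)^-1.
Proof.
move=> q0 q1; have q1' : 0 < 1 - q by rewrite subr_gt0.
suff h : (1 - q) * (\sum_(1 <= n < N.+1) q ^+ n) = q - q ^+ N.+1.
  rewrite -[leRHS]mul1r ler_pdivlMr// mulrC h.
  by have := exprn_ge0 N.+1 q0; lra.
elim: N => [|N ih]; first by rewrite big_geq// mulr0 expr1 subrr.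
by rewrite big_nat_recr//= mulrDr ih [q ^+ N.+2]exprS; ring.
Qed.

Definition dissipation u N := \sum_(1 <= n < N.+1) 4 ^+ n * u n ^+ 2.

Lemma dissipation_ge u N n : (1 <= n <= N)%N -> 4 ^+ n * u n ^+ 2 <= dissipation u N.
Proof.
move=> nN; rewrite /dissipation (bigD1_seq n)/= ?iota_uniq ?mem_index_iota//.
by rewrite lerDl sumr_ge0// => i _; rewrite mulr_ge0 ?sqr_ge0// exprn_ge0.
Qed.

Lemma viscous_energy_le beta nu u N : beta != 0 ->
  (forall n, (1 <= n)%N -> 0 <= u n) ->
  \sum_(1 <= n < N.+1) 2 * (u n * viscous_rhs beta nu n u) <=
  - (2 * nu) * dissipation u N.
Proof.
move=> b0 u0; rewrite -big_distrr/=.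
have -> : \sum_(1 <= n < N.+1) u n * viscous_rhs beta nu n u =
   \sum_(1 <= n < N.+1) u n * inviscid_rhs beta n u - nu * dissipation u N.
  rewrite /dissipation big_distrr/= -sumrB; apply: eq_big_nat => -[//|n] _.
  rewrite viscous_rhsE /lam -exprM mulnC exprM (_ : 2 ^+ 2 = 4); last by ring.
  by ring.
rewrite energy_balance//.
suff : 0 <= lam R N `^ beta * u N ^+ 2 * u N.+1 by lra.
by apply: mulr_ge0; [rewrite mulr_ge0 ?powR_ge0 ?sqr_ge0|exact: u0].
Qed.

(** The flux through mode N, when v has no pointwise decay. Without its
    non-positive terms it is at most
    2 ^ -N b ^ N (v_N^2 u_(N+1) + u_N^2 v_(N+1)). The decay of u turns the first
    product into a small multiple of 4 ^ N v_N^2. In the second one, u_N^2 leaves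
    K^2 rho ^ N 2 ^ N v_(N+1) with rho = b / (4 s^2), and
    2 ^ N v <= 1 + 4 ^ (N+1) v^2. *)
Lemma viscous_boundary_le beta (s K : R) u v N :
  1 <= s -> s <= 2 -> 0 <= K -> (1 <= N)%N ->
  (forall n, (1 <= n)%N -> 0 <= u n <= K / s ^+ n) ->
  (forall n, (1 <= n)%N -> 0 <= v n) ->
  2^-1 ^+ N * lam R N `^ beta * ((v N ^+ 2 - u N ^+ 2) * (u N.+1 - v N.+1)) <=
  (K + K ^+ 2) * (2 `^ beta / (4 * s ^+ 2)) ^+ N * (1 + dissipation v N.+1).
Proof.
move=> s1 s2 K0 N1 bu v0; have s0 : 0 < s by lra.
rewrite lam_powR//; set b := 2 `^ beta; have b0 : 0 <= b by exact: powR_ge0.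
have /andP[u0 u1] := bu N N1; have /andP[u'0 u'1] := bu N.+1 isT.
have vN := v0 N N1; have v'0 := v0 N.+1 isT.
set B := 2^-1 ^+ N * b ^+ N.
have B0 : 0 <= B by rewrite mulr_ge0 ?exprn_ge0.
set rho := (b / (4 * s ^+ 2)) ^+ N.
have Bs : B / s ^+ N <= rho * 4 ^+ N.
  have -> : B / s ^+ N = (b / (8 * s)) ^+ N * 4 ^+ N.
    rewrite /B expr_div_n exprMn exprVn (_ : (8 : R) = 2 * 4); last by ring.
    by rewrite exprMn; field; rewrite !expf_neq0 ?gt_eqF.
  apply: ler_wpM2r; first exact: exprn_ge0.
  apply: lerXn2r; rewrite ?nnegrE ?divr_ge0 ?mulr_ge0 ?exprn_ge0//; try lra.
  apply: ler_wpM2l => //; rewrite lef_pV2 ?posrE ?mulr_gt0 ?exprn_gt0//.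
  have : s * s <= 2 * s by rewrite ler_pM2r.
  by rewrite expr2; lra.
have Bss : B / (s ^+ N) ^+ 2 = rho * 2 ^+ N.
  rewrite /B /rho expr_div_n exprMn exprVn (_ : (4 : R) = 2 * 2); last by ring.
  by rewrite exprMn -!exprM mulnC; field; rewrite !expf_neq0 ?gt_eqF.
have rho0 : 0 <= rho by rewrite exprn_ge0// divr_ge0// mulr_ge0// exprn_ge0// ltW.
have t1 : B * (v N ^+ 2 * u N.+1) <= K * rho * (4 ^+ N * v N ^+ 2).
  have u'2 : u N.+1 <= K / s ^+ N.
    apply: le_trans u'1 _; rewrite ler_wpM2l// lef_pV2 ?posrE ?exprn_gt0//.
    by rewrite exprS ler_peMl// exprn_ge0// ltW.
  have h1 := ler_wpM2l B0 (ler_wpM2l (sqr_ge0 (v N)) u'2).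
  apply: le_trans h1 _.
  have -> : B * (v N ^+ 2 * (K / s ^+ N)) = (B / s ^+ N) * (K * v N ^+ 2).
    by field; rewrite !expf_neq0 ?gt_eqF.
  have -> : K * rho * (4 ^+ N * v N ^+ 2) = (rho * 4 ^+ N) * (K * v N ^+ 2) by ring.
  by apply: ler_wpM2r => //; rewrite mulr_ge0// sqr_ge0.
have t2 : B * (u N ^+ 2 * v N.+1) <= K ^+ 2 * rho * (1 + 4 ^+ N.+1 * v N.+1 ^+ 2).
  have uu : u N ^+ 2 <= K ^+ 2 / (s ^+ N) ^+ 2.
    by rewrite -expr_div_n; apply: lerXn2r => //; rewrite nnegrE// divr_ge0// exprn_ge0// ltW.
  have h1 := ler_wpM2l B0 (ler_wpM2r v'0 uu).
  apply: le_trans h1 _.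
  have -> : B * (K ^+ 2 / (s ^+ N) ^+ 2 * v N.+1) = K ^+ 2 * (B / (s ^+ N) ^+ 2) * v N.+1.
    by field; rewrite !expf_neq0 ?gt_eqF.
  rewrite Bss -!mulrA; apply: ler_wpM2l => //; apply: ler_wpM2l => //.
  apply: ler_wpM2l => //.
  have e4 : (4 : R) ^+ N = (2 ^+ N) ^+ 2.
    by rewrite -exprM mulnC exprM; congr (_ ^+ _); ring.
  rewrite [4 ^+ _]exprS e4.
  have w0 : 0 <= 2 ^+ N * v N.+1 by rewrite mulr_ge0 ?exprn_ge0.
  have -> : 4 * (2 ^+ N) ^+ 2 * v N.+1 ^+ 2 = 4 * (2 ^+ N * v N.+1) ^+ 2 by ring.
  by move: (2 ^+ N * v N.+1) w0 => w w0; nra.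
have d1 := @dissipation_ge v N.+1 N; rewrite N1 leqnSn in d1.
have d2 := @dissipation_ge v N.+1 N.+1; rewrite leqnn in d2.
have {}d1 := ler_wpM2l (mulr_ge0 K0 rho0) (d1 isT).
have {}d2 := ler_wpM2l (mulr_ge0 (sqr_ge0 K) rho0) (d2 isT).
have p1 : 0 <= B * (u N ^+ 2 * u N.+1).
  by apply: mulr_ge0 => //; apply: mulr_ge0 => //; exact: sqr_ge0.
have p2 : 0 <= B * (v N ^+ 2 * v N.+1).
  by apply: mulr_ge0 => //; apply: mulr_ge0 => //; exact: sqr_ge0.
have Kr := mulr_ge0 K0 rho0.
rewrite (_ : (K + K ^+ 2) * _ * _ = K * rho + K * rho * dissipation v N.+1 +
  K ^+ 2 * rho + K ^+ 2 * rho * dissipation v N.+1); last by rewrite /rho; ring.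
rewrite (_ : B * _ = B * (v N ^+ 2 * u N.+1) + B * (u N ^+ 2 * v N.+1) -
  B * (u N ^+ 2 * u N.+1) - B * (v N ^+ 2 * v N.+1)); last by ring.
move: t2; rewrite mulrDr mulr1.
lra.
Qed.

(** The viscous term is estimated by v (u - v) <= u^2 / 4, which leaves only the
    sequence u; the resulting series of 2 ^ n u_n^2 converges as s^2 > 2. *)
Lemma viscous_distance_le beta nu (s K : R) u v N :
  beta != 0 -> 1 <= s -> s <= 2 -> 2 < s ^+ 2 -> 0 <= K -> 0 <= nu -> (1 <= N)%N ->
  (forall n, (1 <= n)%N -> 0 <= u n <= K / s ^+ n) ->
  (forall n, (1 <= n)%N -> 0 <= v n) ->
  \sum_(1 <= n < N.+1) 2^-1 ^+ n * (2 * ((v n - u n) *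
     (viscous_rhs beta nu n v - inviscid_rhs beta n u))) <=
  (K + K ^+ 2) * (2 `^ beta / (4 * s ^+ 2)) ^+ N * (1 + dissipation v N.+1) +
  nu * (K ^+ 2 / 2 / (1 - 2 / s ^+ 2)).
Proof.
move=> b0 s1 s2 ss K0 nu0 N1 bu v0.
have s0 : 0 < s by lra.
have -> : \sum_(1 <= n < N.+1) 2^-1 ^+ n * (2 * ((v n - u n) *
     (viscous_rhs beta nu n v - inviscid_rhs beta n u))) =
  \sum_(1 <= n < N.+1) 2^-1 ^+ n * (2 * ((v n - u n) *
     (inviscid_rhs beta n v - inviscid_rhs beta n u))) +
  \sum_(1 <= n < N.+1) nu * (2 * (2 ^+ n * (v n * (u n - v n)))).
  rewrite -big_split/=; apply: eq_big_nat => -[//|n] _.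
  rewrite viscous_rhsE /lam exprVn; field.
  by rewrite expf_neq0.
apply: lerD.
  apply: le_trans (viscous_boundary_le _ s1 s2 K0 N1 bu v0).
  apply: energy_difference => // n /andP[n1 _]; first exact: v0.
  by case/andP: (bu n n1).
have q0 : 0 <= 2 / s ^+ 2 by rewrite divr_ge0// exprn_ge0// ltW.
have q1 : 2 / s ^+ 2 < 1 by rewrite ltr_pdivrMr ?exprn_gt0// mul1r.
rewrite -big_distrr/=; apply: ler_wpM2l => //.
apply: (@le_trans _ _ (\sum_(1 <= n < N.+1) K ^+ 2 / 2 * (2 / s ^+ 2) ^+ n)); last first.
  rewrite -big_distrr/=; apply: ler_wpM2l; last exact: geometric_sum_le.
  by rewrite divr_ge0// exprn_ge0.
rewrite big_nat [leRHS]big_nat; apply: ler_sum => n /andP[n1 _].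
have /andP[u0 u1] := bu n n1.
have -> : K ^+ 2 / 2 * (2 / s ^+ 2) ^+ n = 2 ^+ n * ((K / s ^+ n) ^+ 2 / 2).
  rewrite !expr_div_n -!exprM mulnC; field.
  by rewrite !expf_neq0 ?gt_eqF.
have p2 : 0 <= (2 : R) ^+ n by rewrite exprn_ge0.
rewrite mulrCA; apply: ler_wpM2l => //.
have := sqr_ge0 (u n - 2 * v n); move: (K / s ^+ n) u0 u1 => a u0 u1.
by move: (u n) (v n) u0 u1 => x y *; nra.
Qed.

(** The energy of V, with the coefficient eps / (2 nu), is added to the weighted
    distance: its derivative is at most - eps times the dissipation, which
    cancels the unbounded part of [viscous_distance_le]. Since eps is of order
    rho ^ N, the added energy disappears as N grows, for fixed nu. *)
Lemma viscous_stability beta nu (s K : R) (x : nat -> R) (X V : nat -> R -> R) :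
  beta != 0 -> 1 <= s -> s <= 2 -> 2 < s ^+ 2 -> 2 `^ beta < 4 * s ^+ 2 ->
  0 <= K -> 0 < nu ->
  (forall n, (1 <= n)%N -> forall t, 0 <= t -> 0 <= X n t <= K / s ^+ n) ->
  inviscid_solution beta x X -> viscous_solution beta nu x V ->
  forall n, (1 <= n)%N -> forall t, 0 <= t ->
    (V n t - X n t) ^+ 2 <= 2 ^+ n * (nu * (K ^+ 2 / 2 / (1 - 2 / s ^+ 2)) * t).
Proof.
move=> b0 s1 s2 ss bss K0 nu0 bX solX solV n n1 t t0.
have s0 : 0 < s by lra.
have x0 k : (1 <= k)%N -> 0 <= x k.
  by move=> k1; have [<- _] := solX k k1; case/andP: (bX k k1 0 (lexx _)).
have V0 := viscous_solution_ge0 x0 solV.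
set c := K ^+ 2 / 2 / (1 - 2 / s ^+ 2).
set rho := 2 `^ beta / (4 * s ^+ 2).
have s20 : 0 < 4 * s ^+ 2 by rewrite mulr_gt0// exprn_gt0.
have rho0 : 0 <= rho by rewrite divr_ge0 ?powR_ge0// ltW.
have rho1 : rho < 1 by rewrite ltr_pdivrMr// mul1r.
have q0 : 0 <= 2 / s ^+ 2 by rewrite divr_ge0// exprn_ge0// ltW.
have q1 : 2 / s ^+ 2 < 1 by rewrite ltr_pdivrMr ?exprn_gt0// mul1r.
set E0 := K ^+ 2 * (1 - 2 / s ^+ 2)^-1.
have E0ge M : \sum_(1 <= n < M.+1) V n 0 ^+ 2 <= E0.
  apply: (@le_trans _ _ (\sum_(1 <= n < M.+1) K ^+ 2 * (2 / s ^+ 2) ^+ n)); last first.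
    by rewrite -big_distrr/=; apply: ler_wpM2l; [exact: exprn_ge0|exact: geometric_sum_le].
  rewrite big_nat [leRHS]big_nat; apply: ler_sum => k /andP[k1 _].
  have [-> _] := solV k k1; have [<- _] := solX k k1.
  have /andP[u0 u1] := bX k k1 0 (lexx _).
  apply: (@le_trans _ _ ((K / s ^+ k) ^+ 2)).
    by apply: lerXn2r => //; rewrite nnegrE// divr_ge0// exprn_ge0// ltW.
  rewrite !expr_div_n -!exprM mulnC; apply: ler_wpM2l; first exact: exprn_ge0.
  by rewrite ler_peMl ?invr_ge0 ?exprn_ge0 ?exprn_ege1// ?ltW//; lra.
have main N : (n <= N)%N -> 2^-1 ^+ n * (V n t - X n t) ^+ 2 <=
    (K + K ^+ 2) * rho ^+ N * (E0 / (2 * nu) + t) + nu * c * t.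
  move=> nN; have N1 : (1 <= N)%N by exact: leq_trans nN.
  set eps := (K + K ^+ 2) * rho ^+ N.
  have eps0 : 0 <= eps by rewrite mulr_ge0 ?exprn_ge0// addr_ge0// exprn_ge0.
  have dPhi r : 0 <= r <= t -> D (fun r =>
     \sum_(1 <= n < N.+1) 2^-1 ^+ n * (V n r - X n r) ^+ 2 +
     eps / (2 * nu) * \sum_(1 <= n < N.+2) V n r ^+ 2) r
     (\sum_(1 <= n < N.+1) 2^-1 ^+ n * (2 * ((V n r - X n r) *
       (viscous_rhs beta nu n (fun k => V k r) - inviscid_rhs beta n (fun k => X k r)))) +
      eps / (2 * nu) * \sum_(1 <= n < N.+2) 2 * (V n r * viscous_rhs beta nu n (fun k => V k r))).
    move=> /andP[r0 _]; apply: nderivD.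
      by apply: nderiv_weighted_distance => k /andP[k1 _];
        [apply: (solV k k1).2.2|apply: (solX k k1).2.2].
    apply: nderivZ; apply: nderiv_sum => k; rewrite mem_index_iota => /andP[k1 _].
    have dV := (solV k k1).2.2 r r0.
    have := nderivM dV dV.
    by rewrite [X in D _ _ X -> _](_ : _ = 2 * (V k r * viscous_rhs beta nu k (fun k => V k r)));
      last by ring.
  have inc := le_increment (lexx 0) t0 dPhi
    (fun x _ => @nderiv_linear R (eps + nu * c) x).
  have {inc}inc := inc _.
  have V0X : \sum_(1 <= n < N.+1) 2^-1 ^+ n * (V n 0 - X n 0) ^+ 2 = 0.
    rewrite big_nat big1// => k /andP[k1 _].
    by rewrite (solV k k1).1 (solX k k1).1 subrr expr0n mulr0.
  rewrite V0X add0r mulr0 subr0 in inc.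
  have e2 : 0 <= eps / (2 * nu) by rewrite divr_ge0// mulr_ge0// ltW.
  have nN' : (1 <= n <= N)%N by rewrite n1.
  have h1 := weighted_distance_ge (fun n => V n t) (fun n => X n t) nN'.
  have h2 : 0 <= \sum_(1 <= n < N.+2) V n t ^+ 2.
    by apply: sumr_ge0 => k _; exact: sqr_ge0.
  have h3 := ler_wpM2l e2 (E0ge N.+1).
  have h4 := mulr_ge0 e2 h2.
  have -> : eps * (E0 / (2 * nu) + t) + nu * c * t =
     eps / (2 * nu) * E0 + (eps + nu * c) * t.
    by field; rewrite gt_eqF.
  suff : forall r, 0 <= r <= t -> 
    \sum_(1 <= n < N.+1) 2^-1 ^+ n * (2 * ((V n r - X n r) *
       (viscous_rhs beta nu n (fun k => V k r) - inviscid_rhs beta n (fun k => X k r)))) +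
      eps / (2 * nu) * \sum_(1 <= n < N.+2) 2 * (V n r * viscous_rhs beta nu n (fun k => V k r))
    <= eps + nu * c.
    by move=> /inc; move: h1 h3 h4; lra.
  move=> r /andP[r0 _].
  have d1 := viscous_distance_le b0 s1 s2 ss K0 (ltW nu0) N1
    (fun k k1 => bX k k1 r r0) (fun k k1 => V0 k k1 r r0).
  have d2 := ler_wpM2l e2 (@viscous_energy_le beta nu _ N.+1 b0 (fun k k1 => V0 k k1 r r0)).
  have e3 : eps / (2 * nu) * (- (2 * nu) * dissipation (fun k => V k r) N.+1) =
      - (eps * dissipation (fun k => V k r) N.+1) by field; rewrite gt_eqF.
  rewrite e3 in d2; apply: le_trans (lerD d1 d2) _.
  by rewrite -/rho -/eps -/c mulrDr mulr1; lra.
rewrite [leRHS]mulrC -ler_pdivrMr ?exprn_gt0// mulrC -exprVn.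
apply/ler_addgt0Pr => e e0.
have [N0 hN] := @geometric_small R ((K + K ^+ 2) * (E0 / (2 * nu) + t)) rho e rho0 rho1 e0.
have := hN (maxn n N0) (leq_maxr _ _); have := main (maxn n N0) (leq_maxl _ _).
by rewrite mulrAC; lra.
Qed.

End Viscous.

(** * The faces of the invariant region *)

Section Region.
Variable R : realType.

(** In this and the next two lemmas p, y, z, w stand for Y_(n-1), Y_n, Y_(n+1),
    Y_(n+2). The expression is, up to the factor c_n, the derivative of
    Y_(n+1) - (3/4 Y_n^2 - 1/5) where this quantity vanishes. *)
Lemma lower_face (mu kappa p y z w : R) :
  0 < mu -> mu <= 4 -> 0 < kappa -> kappa <= 63/125 -> 2 <= mu * kappa ->
  0 <= p <= 1 -> 0 <= y <= 1 -> 0 <= z -> 0 <= w ->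
  z = 3 / 4 * y ^+ 2 - 1 / 5 -> w <= 3 / 5 + z / 2 ->
  0 < mu * (kappa * y ^+ 2 - z * w) - 3 / 2 * y * (kappa * p ^+ 2 - y * z).
Proof.
move=> mu0 mu4 k0 k1 mk /andP[p0 p1] /andP[y0 y1] z0 w0 ez wz.
have h1 : 2 * y ^+ 2 <= mu * kappa * y ^+ 2 by rewrite ler_wpM2r ?sqr_ge0.
have h2 : mu * (z * w) <= 4 * (z * (3 / 5 + z / 2)).
  by apply: ler_pM => //; [exact: ltW|exact: mulr_ge0|exact: ler_wpM2l].
have h3 : y * (kappa * p ^+ 2) <= y * (63 / 125).
  apply: ler_wpM2l => //; rewrite -[leRHS]mulr1; apply: ler_pM => //.
  - exact: ltW.
  - exact: sqr_ge0.
  - by rewrite expr_le1.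
(* The worst case p = 1, w = 3/5 + z/2. The coefficients 3/4 and 1/2 of the
   region make the terms of degree 4 cancel, and the remaining quadratic
   polynomial has no real root. *)
have h4 : 0 < 1 / 2 * y ^+ 2 - 189 / 250 * y + 4 / 10.
  by have := sqr_ge0 (y - 189 / 250); lra.
have e : 2 * y ^+ 2 - 4 * (z * (3 / 5 + z / 2)) - 3 / 2 * (y * (63 / 125)) +
   3 / 2 * (y * (y * z)) = 1 / 2 * y ^+ 2 - 189 / 250 * y + 4 / 10.
  by rewrite ez; field.
rewrite -e in h4.
have -> : mu * (kappa * y ^+ 2 - z * w) - 3 / 2 * y * (kappa * p ^+ 2 - y * z) =
  mu * kappa * y ^+ 2 - mu * (z * w) - 3 / 2 * (y * (kappa * p ^+ 2)) +
  3 / 2 * (y * (y * z)) by field.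
by move: h1 h2 h3 h4; lra.
Qed.

(** Up to the factor c_n, this is the derivative of 3/5 + Y_n / 2 - Y_(n+1) where
    that quantity vanishes. *)
Lemma upper_face (mu kappa p y z w : R) :
  99/25 <= mu -> 0 < kappa -> mu * kappa <= 201/100 ->
  0 <= y <= 1 -> z <= 1 ->
  z = 3 / 5 + y / 2 -> 3 / 4 * z ^+ 2 - 1 / 5 <= w ->
  0 < 1 / 2 * (kappa * p ^+ 2 - y * z) - mu * (kappa * y ^+ 2 - z * w).
Proof.
move=> mu0 k0 mk /andP[y0 y1] z1 ez wz.
have z0 : 0 < z by lra.
have w0 : 0 <= w by apply: le_trans wz; nra.
have h1 : mu * kappa * y ^+ 2 <= 201 / 100 * y ^+ 2 by rewrite ler_wpM2r ?sqr_ge0.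
have h2 : 99 / 25 * (z * (3 / 4 * z ^+ 2 - 1 / 5)) <= mu * (z * w).
  have h := ler_wpM2l (ltW z0) wz.
  have zw : 0 <= z * w by rewrite mulr_ge0// ltW.
  by apply: (@le_trans _ _ (99 / 25 * (z * w))); [rewrite ler_wpM2l|rewrite ler_wpM2r].
have h3 : 0 <= kappa * p ^+ 2 by rewrite mulr_ge0 ?sqr_ge0// ltW.
have h4 : 0 < 99 / 25 * (z * (3 / 4 * z ^+ 2 - 1 / 5)) - 201 / 100 * y ^+ 2 - 1 / 2 * (y * z).
  have -> : y = 2 * z - 6 / 5 by rewrite ez; field.
  have z6 : 3 / 5 <= z by lra.
  (* On [3/5, 1] the cubic polynomial exceeds the affine function with the
     same end values by exactly this product. *)
  have : 0 <= (z - 3 / 5) * (1 - z) * (536 / 125 - 297 / 100 * z).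
    apply: mulr_ge0; first by apply: mulr_ge0; rewrite subr_ge0.
    by clear -z1; lra.
  clear -z1 z6; lra.
have -> : 1 / 2 * (kappa * p ^+ 2 - y * z) - mu * (kappa * y ^+ 2 - z * w) =
  1 / 2 * (kappa * p ^+ 2) - 1 / 2 * (y * z) - mu * kappa * y ^+ 2 + mu * (z * w) by field.
by move: h1 h2 h3 h4; lra.
Qed.

Lemma right_face (kappa p z : R) : kappa <= 63/125 -> 0 < kappa ->
  0 <= p <= 1 -> 3 / 4 - 1 / 5 <= z -> kappa * p ^+ 2 - z < 0.
Proof.
move=> k1 k0 /andP[p0 p1] hz.
have : kappa * p ^+ 2 <= kappa by apply: ler_piMr; [exact: ltW|rewrite expr_le1].
lra.
Qed.

End Region.

(** * The truncated systems *)

Section Truncation.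
Variable R : realType.
Implicit Types (t e : R).
Local Notation D := (@has_derivative_nneg R).

Definition clip (z : R) : R := Num.max 0 (Num.min 1 z).

Lemma clip_itv z : 0 <= clip z <= 1.
Proof. by rewrite /clip le_max lexx ge_max ler01 ge_min lexx. Qed.

Lemma clip_id z : 0 <= z <= 1 -> clip z = z.
Proof. by move=> /andP[z0 z1]; rewrite /clip min_r// max_r. Qed.

Lemma clip_le0 z : z <= 0 -> clip z = 0.
Proof. by move=> z0; rewrite /clip max_l// ge_min z0 orbT. Qed.

Lemma clip_lip a b : `|clip a - clip b| <= `|a - b|.
Proof.
wlog ab : a b / a <= b => [h|].
  have [/h//|/ltW /h] := leP a b.
  by rewrite distrC [`|b - a|]distrC.
rewrite distrC [`|a - b|]distrC !ger0_norm ?subr_ge0//; last first.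
  rewrite /clip !maxEle !minEle; case: (leP 1 a) => ?; case: (leP 1 b) => ?;
    do ?case: ifP => ?; lra.
rewrite /clip !maxEle !minEle; case: (leP 1 a) => ?; case: (leP 1 b) => ?;
    do ?case: ifP => ?; lra.
Qed.

(** The sequence to which the quadratic right-hand side is applied: zero at 0,
    values truncated to [0, 1], and mode N repeated from N on, which closes the
    system at mode N. *)
Definition truncated_state N (u : nat -> R) k :=
  if k is 0 then 0 else clip (u (minn k N)).

Definition truncated_rhs (C mu kappa : R) N (u : nat -> R) n :=
  if (1 <= n <= N)%N then
    C * mu ^+ n * (kappa * truncated_state N u n.-1 ^+ 2 -
                   truncated_state N u n * truncated_state N u n.+1)
  else 0.

Lemma truncated_state_itv N u k : 0 <= truncated_state N u k <= 1.
Proof. by case: k => [|k]; [rewrite /= lexx ler01|exact: clip_itv]. Qed.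

Lemma truncated_state_lip N u v e k : (forall k, `|u k - v k| <= e) ->
  `|truncated_state N u k - truncated_state N v k| <= e.
Proof.
move=> h; case: k => [|k] /=; last by apply: le_trans (clip_lip _ _) _; exact: h.
by rewrite subrr normr0; apply: le_trans (h 0%N).
Qed.

Lemma truncated_exists (C mu kappa : R) N y0 : 0 <= C -> 1 <= mu -> 0 <= kappa ->
  exists Z : nat -> R -> R, (forall n, Z n 0 = y0 n) /\
  forall n t, 0 <= t -> D (Z n) t (truncated_rhs C mu kappa N (fun k => Z k t) n).
Proof.
move=> C0 mu1 k0.
have cN n : (n <= N)%N -> 0 <= C * mu ^+ n <= C * mu ^+ N.
  move=> nN; have m0 : 0 <= mu by lra.
  by rewrite mulr_ge0 ?exprn_ge0//=; apply: ler_wpM2l => //; exact: ler_weXn2l.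
have cN0 : 0 <= C * mu ^+ N by case/andP: (cN N (leqnn N)).
apply: (@picard R (truncated_rhs C mu kappa N) (C * mu ^+ N * (kappa + 1))
  (C * mu ^+ N * (2 * kappa + 2) + 1)).
- by rewrite mulr_ge0//; lra.
- by rewrite lerDr mulr_ge0//; lra.
- move=> u n; rewrite /truncated_rhs; case: ifP => [/andP[n1 nN]|_]; last first.
    by rewrite normr0 mulr_ge0//; lra.
  have /andP[c0 c1] := cN n nN.
  rewrite normrM (ger0_norm c0); apply: ler_pM => //.
  have /andP[a0 a1] := truncated_state_itv N u n.-1.
  have /andP[b0 b1] := truncated_state_itv N u n.
  have /andP[d0 d1] := truncated_state_itv N u n.+1.
  move: (truncated_state N u n.-1) (truncated_state N u n) (truncated_state N u n.+1) a0 a1 b0 b1 d0 d1.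
  move=> a b d a0 a1 b0 b1 d0 d1.
  have h1 : 0 <= kappa * a ^+ 2 <= kappa.
    rewrite mulr_ge0 ?sqr_ge0//=; apply: ler_piMr => //; exact: exprn_ile1.
  have h2 : 0 <= b * d <= 1 by rewrite mulr_ge0//= mulr_ile1.
  by rewrite ler_norml; apply/andP; split; lra.
- move=> u v e n h; rewrite /truncated_rhs.
  have e0 : 0 <= e by apply: le_trans (h 0%N).
  case: ifP => [/andP[n1 nN]|_]; last first.
    by rewrite subrr normr0 mulr_ge0// addr_ge0// mulr_ge0//; lra.
  have /andP[c0 c1] := cN n nN.
  rewrite -mulrBr normrM (ger0_norm c0) mulrDl mul1r -mulrA.
  apply: (@le_trans _ _ (C * mu ^+ N * ((2 * kappa + 2) * e))); last by rewrite lerDl.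
  apply: ler_pM => //.
  have /andP[a0 a1] := truncated_state_itv N u n.-1.
  have /andP[b0 b1] := truncated_state_itv N u n.
  have /andP[d0 d1] := truncated_state_itv N u n.+1.
  have /andP[a'0 a'1] := truncated_state_itv N v n.-1.
  have /andP[b'0 b'1] := truncated_state_itv N v n.
  have /andP[d'0 d'1] := truncated_state_itv N v n.+1.
  have := truncated_state_lip N n.-1 h.
  have := truncated_state_lip N n h.
  have := truncated_state_lip N n.+1 h.
  move: (truncated_state N u n.-1) (truncated_state N u n) (truncated_state N u n.+1) a0 a1 b0 b1 d0 d1.
  move: (truncated_state N v n.-1) (truncated_state N v n) (truncated_state N v n.+1) a'0 a'1 b'0 b'1 d'0 d'1.
  move=> a' b' d' ? ? ? ? ? ? a b d ? ? ? ? ? ? hd hb ha.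
  have -> : kappa * a ^+ 2 - b * d - (kappa * a' ^+ 2 - b' * d') =
    kappa * ((a - a') * (a + a')) - ((b - b') * d + (d - d') * b') by ring.
  apply: le_trans (ler_normB _ _) _.
  have -> : (2 * kappa + 2) * e = kappa * (e * 2) + (e * 1 + e * 1) by ring.
  apply: lerD.
    rewrite normrM (ger0_norm k0); apply: ler_wpM2l => //.
    by rewrite normrM; apply: ler_pM => //; rewrite ger0_norm; lra.
  apply: le_trans (ler_normD _ _) _.
  by rewrite !normrM; apply: lerD; apply: ler_pM => //; rewrite ger0_norm.
Qed.

(** A negative component is truncated to 0, so that its outflow vanishes and only
    the inflow, which is a square, remains. *)
Lemma truncated_ge0 (C mu kappa : R) N (Z : nat -> R -> R) : 0 <= C -> 0 <= mu -> 0 <= kappa ->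
  (forall n t, 0 <= t -> D (Z n) t (truncated_rhs C mu kappa N (fun k => Z k t) n)) ->
  forall n, (1 <= n <= N)%N -> 0 <= Z n 0 -> forall t, 0 <= t -> 0 <= Z n t.
Proof.
move=> C0 mu0 k0 dZ n nN Z0 t t0.
apply/ler_addgt0Pr => e e0.
pose d := e / (t + 1).
have t1 : 0 < t + 1 by lra.
have d0 : 0 < d by rewrite divr_gt0.
have := @barrier R unit (fun _ t => Z n t + d * (t + 1))
  (fun _ t => truncated_rhs C mu kappa N (fun k => Z k t) n + d * (1 + 0)) 0 t (lexx _).
move=> /(_ _ _ _ tt t); rewrite /d divfK ?gt_eqF// -/d; apply.
- move=> _ s /andP[s0 _] /=; apply: nderivD; first exact: dZ.
  by apply: nderivZ; apply: nderivD; [exact: nderiv_id|exact: nderiv_cst].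
- by move=> _; rewrite add0r mulr1 addr_ge0// ltW.
- move=> s /andP[s0 _] _ _ /eqP; rewrite addr_eq0 => /eqP Zs.
  have Zs0 : Z n s <= 0 by rewrite Zs oppr_le0 mulr_ge0 ?ltW//; lra.
  rewrite addr0 mulr1 ltr_wpDl// /truncated_rhs nN.
  case: n nN {Z0} Zs Zs0 => // n nN _ Zs0.
  rewrite {2}/truncated_state (minn_idPl (proj2 (andP nN))) clip_le0// mul0r subr0.
  by apply: mulr_ge0; apply: mulr_ge0 => //; [exact: exprn_ge0|exact: sqr_ge0].
- by rewrite t0 lexx.
Qed.

(** Inside the region the truncation of values has no effect, so that the
    solution of the truncated system solves the original equations up to mode N.
    The numeric hypotheses place mu and kappa near 4 and 1/2. *)
Lemma truncated_system_in_region (C mu kappa : R) N (y0 : nat -> R) :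
  99 / 25 <= mu -> mu <= 4 -> 0 < kappa -> kappa <= 63 / 125 ->
  2 <= mu * kappa -> mu * kappa <= 201 / 100 -> 0 < C -> (1 <= N)%N ->
  (forall n, 0 <= y0 n <= 1 / 2) ->
  exists Y : nat -> R -> R, [/\ forall n, (1 <= n <= N)%N -> Y n 0 = y0 n,
    forall t, Y 0%N t = 0,
    forall n t, 0 <= t -> (1 <= n <= N.+1)%N -> 0 <= Y n t <= 1 &
    forall n t, (1 <= n <= N)%N -> 0 <= t ->
      D (Y n) t (C * mu ^+ n * (kappa * Y n.-1 t ^+ 2 - Y n t * Y n.+1 t))].
Proof.
move=> mu1 mu4 k0 k1 mk1 mk2 C0 N1 y00.
have mu0 : 0 < mu by lra.
have [Z [Z0 dZ]] := @truncated_exists C mu kappa N y0 (ltW C0) ltac:(lra) (ltW k0).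
have Zge0 n t : (1 <= n <= N)%N -> 0 <= t -> 0 <= Z n t.
  move=> nN; apply: (truncated_ge0 (ltW C0) (ltW mu0) (ltW k0) dZ nN).
  by rewrite Z0; case/andP: (y00 n).
pose y t k := truncated_state N (fun k => Z k t) k.
pose rhs t n := truncated_rhs C mu kappa N (fun k => Z k t) n.
have rhsE t n : (1 <= n.+1 <= N)%N ->
    rhs t n.+1 = C * mu ^+ n.+1 * (kappa * y t n ^+ 2 - y t n.+1 * y t n.+2).
  by move=> nN; rewrite /rhs /truncated_rhs nN.
(* One index for each face: the lower and upper constraints between the modes
   n and n + 1 for 1 <= n < N, and the constraint Y_n <= 1 for 1 <= n <= N. *)
pose I : finType := ('I_N.-1 + 'I_N.-1 + 'I_N)%type.
pose f (i : I) t := match i with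
  | inl (inl i) => Z i.+2 t - (3 / 4 * (Z i.+1 t * Z i.+1 t) - 1 / 5)
  | inl (inr i) => 3 / 5 + 1 / 2 * Z i.+1 t - Z i.+2 t
  | inr i => 1 - Z i.+1 t
  end.
pose f' (i : I) t := match i with
  | inl (inl i) => rhs t i.+2 - (3 / 4 * (rhs t i.+1 * Z i.+1 t + Z i.+1 t * rhs t i.+1) - 0)
  | inl (inr i) => 0 + 1 / 2 * rhs t i.+1 - rhs t i.+2
  | inr i => 0 - rhs t i.+1
  end.
have region : forall i t, 0 <= t -> 0 <= f i t.
  move=> i t t0.
  apply: (@barrier R I f f' 0 t (lexx _)) => //; last by rewrite t0 lexx.
  - move=> [[j|j]|j] s /andP[s0 _] /=.
    + apply: nderivB; first exact: dZ.
      apply: nderivB; last exact: nderiv_cst.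
      by apply: nderivZ; apply: nderivM; exact: dZ.
    + apply: nderivB; last exact: dZ.
      by apply: nderivD; [exact: nderiv_cst|apply: nderivZ; exact: dZ].
    + by apply: nderivB; [exact: nderiv_cst|exact: dZ].
  - move=> [[j|j]|j] /=; rewrite !Z0; have /andP[a0 a1] := y00 j.+1; last by lra.
      have /andP[b0 b1] := y00 j.+2.
      have : y0 j.+1 * y0 j.+1 <= 1 / 2 * (1 / 2) by apply: ler_pM.
      by lra.
    by have /andP[b0 b1] := y00 j.+2; lra.
  - move=> s /andP[s0 _] fs.
    have Zle1 n : (1 <= n <= N)%N -> 0 <= Z n s <= 1.
      move=> /[dup] nN; rewrite Zge0//=; case: n nN => // n nN nN'.
      by have := fs (inr (Ordinal nN)); rewrite /= subr_ge0.
    have yZ n : (1 <= n <= N)%N -> y s n = Z n s.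
      move=> /[dup] nN /andP[n1 nN']; rewrite /y; case: n n1 nN nN' => // n _ nN nN'.
      by rewrite /truncated_state (minn_idPl nN') clip_id ?Zle1.
    have y01 k : 0 <= y s k <= 1 by exact: truncated_state_itv.
    have yN : y s N.+1 = y s N.
      have ycl k : (1 <= k)%N -> y s k = clip (Z (minn k N) s) by case: k.
      by rewrite !ycl// (minn_idPr (leqnSn _)) minnn.
    (* For n = N the constraints are not part of the family: they follow from the
       closure Y_(N+1) = Y_N and 0 <= Y_N <= 1. *)
    have ylow n : (1 <= n <= N)%N -> 3 / 4 * y s n ^+ 2 - 1 / 5 <= y s n.+1.
      move=> /andP[n1]; rewrite leq_eqVlt => /orP[/eqP->|nN].
        rewrite yN; have /andP[a0 a1] := y01 N; move: (y s N) a0 a1 => a a0 a1.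
        by have : a ^+ 2 <= a by [rewrite expr2 ler_piMr|]; lra.
      case: n n1 nN => // n _ nN.
      have hn : (n < N.-1)%N by rewrite -ltnS prednK.
      have h : 0 <= Z n.+2 s - (3 / 4 * (Z n.+1 s * Z n.+1 s) - 1 / 5) :=
        fs (inl (inl (Ordinal hn))).
      by rewrite -!yZ ?(ltnW nN)// in h; lra.
    have yup n : (1 <= n <= N)%N -> y s n.+1 <= 3 / 5 + y s n / 2.
      move=> /andP[n1]; rewrite leq_eqVlt => /orP[/eqP->|nN].
        by rewrite yN; have /andP[a0 a1] := y01 N; lra.
      case: n n1 nN => // n _ nN.
      have hn : (n < N.-1)%N by rewrite -ltnS prednK.
      have h : 0 <= 3 / 5 + 1 / 2 * Z n.+1 s - Z n.+2 s := fs (inl (inr (Ordinal hn))).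
      by rewrite -!yZ ?(ltnW nN)// in h; lra.
    have cn n : 0 < C * mu ^+ n by rewrite mulr_gt0// exprn_gt0.
    move=> [[j|j]|j] h0.
    + have jN : (j.+1 < N)%N by have := ltn_ord j; rewrite -ltnS prednK.
      have j1 : (1 <= j.+1 <= N)%N := ltnW jN.
      have j2 : (1 <= j.+2 <= N)%N := jN.
      change (Z j.+2 s - (3 / 4 * (Z j.+1 s * Z j.+1 s) - 1 / 5) = 0) in h0.
      change (0 < rhs s j.+2 - (3 / 4 * (rhs s j.+1 * Z j.+1 s + Z j.+1 s * rhs s j.+1) - 0)).
      rewrite -!yZ// in h0; rewrite !rhsE// -!yZ//.
      have /andP[z0 z1] := y01 j.+2; have /andP[w0 w1] := y01 j.+3.
      have := @lower_face R mu kappa (y s j) (y s j.+1) (y s j.+2) (y s j.+3)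
        mu0 mu4 k0 k1 mk1 (y01 j) (y01 j.+1) z0 w0 _ (yup _ j2).
      have ez : y s j.+2 = 3 / 4 * y s j.+1 ^+ 2 - 1 / 5 by move: h0; lra.
      move=> /(_ ez) /(mulr_gt0 (cn j.+1)).
      set a := (X in 0 < X -> _); set b := (X in _ -> 0 < X).
      by have -> : a = b by rewrite /a /b [mu ^+ j.+2]exprS; field.
    + have jN : (j.+1 < N)%N by have := ltn_ord j; rewrite -ltnS prednK.
      have j1 : (1 <= j.+1 <= N)%N := ltnW jN.
      have j2 : (1 <= j.+2 <= N)%N := jN.
      change (3 / 5 + 1 / 2 * Z j.+1 s - Z j.+2 s = 0) in h0.
      change (0 < 0 + 1 / 2 * rhs s j.+1 - rhs s j.+2).
      rewrite -!yZ// in h0; rewrite !rhsE//.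
      have /andP[z0 z1] := y01 j.+2.
      have := @upper_face R mu kappa (y s j) (y s j.+1) (y s j.+2) (y s j.+3)
        mu1 k0 mk2 (y01 j.+1) z1 _ (ylow _ j2).
      have ez : y s j.+2 = 3 / 5 + y s j.+1 / 2 by move: h0; lra.
      move=> /(_ ez) /(mulr_gt0 (cn j.+1)).
      set a := (X in 0 < X -> _); set b := (X in _ -> 0 < X).
      by have -> : a = b by rewrite /a /b [mu ^+ j.+2]exprS; field.
    + have j1 : (1 <= j.+1 <= N)%N := ltn_ord j.
      change (1 - Z j.+1 s = 0) in h0; change (0 < 0 - rhs s j.+1).
      rewrite -!yZ// in h0; rewrite !rhsE//.
      have e1 : y s j.+1 = 1 by move: h0; lra.
      have := ylow _ j1; rewrite e1 expr1n mulr1 => lo.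
      have := right_face k1 k0 (y01 j) lo.
      by rewrite sub0r -mulrN mul1r => ?; apply: mulr_gt0 => //; lra.
have Zle1 n t : (1 <= n <= N)%N -> 0 <= t -> 0 <= Z n t <= 1.
  move=> nN t0; rewrite Zge0//=; case: n nN => // n nN.
  by have := region (inr (Ordinal nN)) t t0; rewrite /= subr_ge0.
pose Y n t := if n is 0 then 0 else Z (minn n N) t.
have minN n : (1 <= n <= N.+1)%N -> (1 <= minn n N <= N)%N.
  by case/andP => n1 _; rewrite leq_min n1 N1 geq_minr.
exists Y; split => //.
- by move=> [//|n] nN; rewrite /Y (minn_idPl (proj2 (andP nN))).
- by move=> [//|n] t t0 nN; rewrite /Y; apply: Zle1 => //; exact: minN.
- move=> n t nN t0.
  have yY k : (k <= N.+1)%N -> y t k = Y k t.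
    case: k => // k kN; rewrite /y /Y /truncated_state clip_id//.
    by apply: Zle1 => //; exact: minN.
  have YZ : Y n = Z n.
    by case: n nN => // n nN; rewrite /Y (minn_idPl (proj2 (andP nN))).
  have := dZ n t t0; rewrite -/(rhs t n) -YZ; case: n nN {YZ} => // n nN.
  have nN' : (n < N)%N := nN.
  by rewrite rhsE// (yY _ (leqW (ltnW nN'))) (yY n.+1 (leqW nN')) (yY n.+2 nN').
Qed.

End Truncation.

(** * Existence of a bounded solution *)

Section Existence.
Variable R : realType.
Implicit Types (t e s K gamma : R) (x : nat -> R).
Local Notation D := (@has_derivative_nneg R).

Lemma sqr_two_powR_5_2 : (2 `^ (5 / 2) : R) ^+ 2 = 32.
Proof.
rewrite -powR_mulrn ?powR_ge0// -powRrM (_ : 5 / 2 * 2%:R = 5%:R); last by field.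
by rewrite powR_mulrn//; ring.
Qed.

(** All the conditions reduce to 2 < s^2 <= (17/12)^2, as b^2 = 32 and
    (b / s) (s^3 / b) = s^2; the number 17/12 is a convergent of the square root
    of 2 from above. *)
Lemma scaling_constants s (b := 2 `^ (5 / 2)) : 0 < s -> 2 < s ^+ 2 -> s <= 17 / 12 ->
  [/\ 99 / 25 <= b / s <= 4, 0 < s ^+ 3 / b <= 63 / 125,
      2 <= b / s * (s ^+ 3 / b) <= 201 / 100,
      0 <= b / (2 * s ^+ 3) < 1 & b < 4 * s ^+ 2].
Proof.
move=> s0 ss s1.
have b2 : b ^+ 2 = 32 by exact: sqr_two_powR_5_2.
have b0 : 0 < b by exact: powR_gt0.
have ss2 : s ^+ 2 <= 289 / 144.
  have -> : 289 / 144 = (17 / 12) ^+ 2 :> R by field.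
  by apply: lerXn2r => //; rewrite nnegrE; lra.
have sle (u v : R) : 0 <= u -> 0 <= v -> u ^+ 2 <= v ^+ 2 -> u <= v.
  by move=> u0 v0; rewrite ler_sqr.
have slt (u v : R) : 0 <= u -> 0 <= v -> u ^+ 2 < v ^+ 2 -> u < v.
  by move=> u0 v0; rewrite ltr_sqr.
(* A bound on b / s sharper than 99/25 is needed for the bound on
   s^3 / b = s^2 / (b / s). *)
have h399 : 399 / 100 * s <= b.
  apply: sle; [lra|lra|rewrite b2 exprMn]; move: (s ^+ 2) ss2 => w ?.
  have w1 : 399 / 100 * w <= 801 / 100 by lra.
  have w2 : 399 / 100 * (399 / 100 * w) <= 399 / 100 * (801 / 100).
    by apply: ler_wpM2l; [lra|exact: w1].
  by rewrite expr2 -mulrA; apply: le_trans w2 _; lra.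
have s3 : 0 < s ^+ 3 by rewrite exprn_gt0.
have s3E : s ^+ 3 = s ^+ 2 * s by rewrite exprSr.
split.
- rewrite ler_pdivlMr// ler_pdivrMr//; apply/andP; split; first by lra.
  by apply: sle; [lra|lra|rewrite b2 exprMn; lra].
- rewrite divr_gt0//= ler_pdivrMr// s3E.
  have : s ^+ 2 * s <= 289 / 144 * s by rewrite ler_pM2r.
  by lra.
- have -> : b / s * (s ^+ 3 / b) = s ^+ 2 by field; rewrite !gt_eqF.
  by apply/andP; split; lra.
- rewrite divr_ge0 ?mulr_ge0 ?ltW//= ltr_pdivrMr ?mulr_gt0// mul1r.
  apply: slt; [exact: ltW|by rewrite mulr_ge0 ?ltW|].
  rewrite b2 exprMn -exprM mulnC exprM.
  have : 2 ^+ 3 < (s ^+ 2) ^+ 3.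
    by rewrite ltrXn2r// nnegrE ltW// exprn_gt0.
  by move: ((s ^+ 2) ^+ 3) => w; lra.
- apply: slt; [exact: ltW|by rewrite mulr_ge0 ?ltW ?exprn_gt0|].
  rewrite b2 exprMn; have : 2 ^+ 2 < (s ^+ 2) ^+ 2.
    by rewrite ltrXn2r// nnegrE ltW// exprn_gt0.
  by move: ((s ^+ 2) ^+ 2) => w; lra.
Qed.

(** [truncated_system_in_region] in the original variables X_n = K s ^ -n Y_n. *)
Lemma truncated_solution s K x N : 0 < s -> 2 < s ^+ 2 -> s <= 17 / 12 -> 0 < K ->
  (forall n, (1 <= n)%N -> 0 <= x n) ->
  (forall n, (1 <= n)%N -> s ^+ n * x n <= K / 2) -> (1 <= N)%N ->
  exists X : nat -> R -> R, [/\ forall n, (1 <= n <= N)%N -> X n 0 = x n,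
    forall t, X 0%N t = 0,
    forall n t, 0 <= t -> (1 <= n <= N.+1)%N -> 0 <= X n t <= K / s ^+ n &
    forall n t, (1 <= n <= N)%N -> 0 <= t ->
      D (X n) t (inviscid_rhs (5 / 2) n (fun k => X k t))].
Proof.
move=> s0 ss s1 K0 x0 xK N1.
set b := 2 `^ (5 / 2) : R.
have [/andP[mu1 mu4] /andP[k0 k1] /andP[mk1 mk2] _ _] := scaling_constants s0 ss s1.
have b0 : 0 < b by exact: powR_gt0.
have sn n : 0 < s ^+ n by rewrite exprn_gt0.
pose y0 n := if n is 0 then 0 else s ^+ n * x n / K.
have y0P n : 0 <= y0 n <= 1 / 2.
  case: n => [|n]; rewrite /y0; first by apply/andP; split; lra.
  rewrite divr_ge0 ?mulr_ge0 ?x0 ?(ltW K0) ?(ltW (sn _))//= ler_pdivrMr//.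
  by have := xK n.+1 isT; lra.
have Ks : 0 < K / s by rewrite divr_gt0.
have [Y [Y0 Y00 Y01 dY]] := truncated_system_in_region mu1 mu4 k0 k1 mk1 mk2 Ks N1 y0P.
exists (fun n t => K / s ^+ n * Y n t); split.
- move=> [//|n] nN; rewrite Y0// /y0.
  by field; rewrite !gt_eqF.
- by move=> t; rewrite Y00 mulr0.
- move=> n t t0 nN; have /andP[h0 h1] := Y01 n t t0 nN.
  have Kn : 0 <= K / s ^+ n by rewrite divr_ge0 ?ltW.
  by rewrite mulr_ge0//= ler_piMr.
- move=> n t nN t0; have := @nderivZ R (K / s ^+ n) _ _ _ (dY n t nN t0).
  rewrite /inviscid_rhs (@lam_powR R n); last by case/andP: nN.
  rewrite -/b; set l := (X in D _ _ X -> _); set r := (X in _ -> D _ _ X).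
  suff -> : l = r by [].
  rewrite /l /r {l r}; case: n nN => [//|[|n]] nN /=.
    rewrite Y00 powR0 ?mul0r; last by rewrite gt_eqF//; lra.
    by rewrite !expr2 !expr1; field; rewrite !gt_eqF.
  rewrite (@lam_powR R n.+1)// -/b expr_div_n.
  rewrite ![_ ^+ n.+3]exprS ![_ ^+ n.+2]exprS ![_ ^+ n.+1]exprS.
  by field; rewrite !gt_eqF.
Qed.

Lemma loc_unif_shift (u : nat -> R -> R) f m : loc_unif_cvg u f ->
  loc_unif_cvg (fun k => u (k + m)%N) f.
Proof.
move=> uf T e e0; have [k0 hk] := uf T e e0; exists k0 => k kk.
by apply: hk; apply: leq_trans kk (leq_addr _ _).
Qed.

(** For each n, the n-th components of the truncated solutions are uniformly
    Cauchy on [0, T] by [inviscid_stability], and the right-hand side of mode n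
    involves finitely many of them, so that it converges as well. *)
Lemma inviscid_exists s K x : 0 < s -> 2 < s ^+ 2 -> s <= 17 / 12 -> 0 < K ->
  (forall n, (1 <= n)%N -> 0 <= x n) ->
  (forall n, (1 <= n)%N -> s ^+ n * x n <= K / 2) ->
  exists X : nat -> R -> R, inviscid_solution (5 / 2) x X /\
    forall n, (1 <= n)%N -> forall t, 0 <= t -> 0 <= X n t <= K / s ^+ n.
Proof.
move=> s0 ss s1 K0 x0 xK.
have [_ _ _ /andP[r0 r1] _] := scaling_constants s0 ss s1.
set r := 2 `^ (5 / 2) / (2 * s ^+ 3) in r0 r1.
have s1' : 1 <= s by rewrite leNgt; apply/negP => s1'; nra.
have b0 : 5 / 2 != 0 :> R by rewrite gt_eqF//; lra.
have [Xs hXs] := choice (fun k => truncated_solution s0 ss s1 K0 x0 xK (ltn0Sn k)).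
have init k n : (1 <= n <= k.+1)%N -> Xs k n 0 = x n by have [h _ _ _] := hXs k; exact: h.
have zero k t : Xs k 0%N t = 0 by have [_ h _ _] := hXs k; exact: h.
have bnd k n t : 0 <= t -> (1 <= n <= k.+2)%N -> 0 <= Xs k n t <= K / s ^+ n.
  by have [_ _ h _] := hXs k; exact: h.
have dX k n t : (1 <= n <= k.+1)%N -> 0 <= t ->
    D (Xs k n) t (inviscid_rhs (5 / 2) n (fun j => Xs k j t)).
  by have [_ _ _ h] := hXs k; exact: h.
have stab k j n t : (1 <= n <= k.+1)%N -> (k <= j)%N -> 0 <= t ->
    (Xs j n t - Xs k n t) ^+ 2 <= 2 ^+ n * (K ^+ 3 * r ^+ k.+1 * t).
  move=> nk kj t0.
  have le1 m i : (i <= k.+1 + m)%N -> (i <= j.+1 + m)%N.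
    by move=> h; apply: leq_trans h _; rewrite leq_add2r ltnS.
  apply: (@inviscid_stability R (5 / 2) s K (Xs j) (Xs k) k.+1 b0 s1') => //.
  - move=> i /andP[i1 ik] u u0; apply: dX => //; rewrite i1/=.
    by apply: leq_trans ik _; rewrite ltnS.
  - by move=> i ik u u0; apply: dX.
  - move=> i /andP[i1 ik] u u0; apply: bnd => //; rewrite i1/=.
    by apply: leq_trans ik _; rewrite !ltnS.
  - by move=> i ik u u0; apply: bnd.
  - move=> i /[dup] ik' /andP[i1 ik]; rewrite !init// i1/=.
    by apply: leq_trans ik _; rewrite ltnS.
have ex_lim n : exists f, loc_unif_cvg (fun k => Xs k n) f.
  case: n => [|n].
    exists (fun=> 0) => T e e0; exists 0%N => k _ t _.
    by rewrite zero subrr normr0 ltW.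
  apply: loc_unif_cauchy => T e e0.
  have [k0 hk] := @geometric_small R (2 ^+ n.+1 * (K ^+ 3 * Num.max 0 T)) r (e ^+ 2) r0 r1
    (exprn_gt0 2 e0).
  have main j k t : (maxn n k0 <= k)%N -> (k <= j)%N -> 0 <= t <= T ->
      `|Xs j n.+1 t - Xs k n.+1 t| <= e.
    rewrite geq_max => /andP[nk kk] kj /andP[t0 tT].
    rewrite -(@ler_pXn2r _ 2) ?nnegrE ?normr_ge0 ?(ltW e0)//.
    rewrite -normrX ger0_norm ?sqr_ge0//.
    have nk1 : (1 <= n.+1 <= k.+1)%N by rewrite ltnS.
    apply: le_trans (stab k j n.+1 t nk1 kj t0) (le_trans _ (hk k.+1 (leqW kk))).
    rewrite [leRHS](_ : _ = 2 ^+ n.+1 * (K ^+ 3 * r ^+ k.+1 * Num.max 0 T)); last by ring.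
    apply: ler_wpM2l; first exact: exprn_ge0.
    apply: ler_wpM2l; last by rewrite le_max tT orbT.
    by apply: mulr_ge0; apply: exprn_ge0 => //; exact: ltW.
  exists (maxn n k0) => j k hj hk' t tT; have [kj|/ltnW jk] := leqP k j.
    exact: main.
  by rewrite distrC; exact: main.
have [X hX] := choice ex_lim.
have near_eq n t : 0 <= t -> forall e, 0 < e ->
    exists2 k, (n <= k)%N & `|Xs k n t - X n t| <= e.
  move=> t0 e e0; have [k0 hk] := hX n t e e0; exists (maxn n k0); first exact: leq_maxl.
  by apply: hk; [exact: leq_maxr|rewrite t0 lexx].
have Xbnd n : (1 <= n)%N -> forall t, 0 <= t -> 0 <= X n t <= K / s ^+ n.
  move=> n1 t t0; apply/andP; split; apply/ler_addgt0Pr => e e0;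
    have [k nk] := near_eq n t t0 e e0; rewrite ler_norml => /andP[h1 h2];
    have /andP[b1 b2] : 0 <= Xs k n t <= K / s ^+ n
      by [apply: bnd => //; rewrite n1/= leqW// leqW]; lra.
have sn n : 1 <= s ^+ n by exact: exprn_ege1.
have KsK n : K / s ^+ n <= K.
  by rewrite ler_piMr ?(ltW K0)// invf_le1 ?sn// (lt_le_trans ltr01 (sn n)).
have XsK k n t : 0 <= t -> (n <= k.+2)%N -> `|Xs k n t| <= K.
  move=> t0; case: n => [|n] nk; first by rewrite zero normr0 ltW.
  have /andP[h0 h1] := bnd k n.+1 t t0 nk.
  by rewrite ger0_norm// (le_trans h1 (KsK _)).
have X0E t : 0 <= t -> X 0%N t = 0.
  move=> t0; apply/eqP; rewrite -normr_le0; apply/ler_addgt0Pr => e e0.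
  by have [k _] := near_eq 0%N t t0 e e0; rewrite zero sub0r normrN add0r.
have XK n t : 0 <= t -> `|X n t| <= K.
  move=> t0; case: n => [|n]; first by rewrite X0E// normr0 ltW.
  have /andP[h0 h1] := Xbnd n.+1 isT t t0.
  by rewrite ger0_norm// (le_trans h1 (KsK _)).
have dXlim n : (1 <= n)%N -> forall t, 0 <= t ->
    D (X n) t (inviscid_rhs (5 / 2) n (fun k => X k t)).
  move=> n1; apply: (@loc_unif_nderiv R (fun k => Xs (k + n)%N n)
    (fun k t => inviscid_rhs (5 / 2) n (fun j => Xs (k + n)%N j t))).
  - move=> k t t0; apply: dX => //; rewrite n1/=.
    by rewrite leqW// leq_addl.
  - exact: (loc_unif_shift n (hX n)).
  rewrite /inviscid_rhs; apply: loc_unifB.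
    apply: loc_unifZ.
    apply: (@loc_unifM R (fun k => Xs (k + n)%N n.-1) (X n.-1)
      (fun k => Xs (k + n)%N n.-1) (X n.-1) K) => //.
    + by move=> k t t0; apply: XsK => //; apply: leq_trans (leq_pred n) (leqW (leqW (leq_addl k n))).
    + by move=> t t0; exact: XK.
    + exact: (loc_unif_shift n (hX n.-1)).
    + exact: (loc_unif_shift n (hX n.-1)).
  set c := lam R n `^ (5 / 2).
  have -> : (fun k t => c * Xs (k + n)%N n t * Xs (k + n)%N n.+1 t) =
    (fun k t => c * (Xs (k + n)%N n t * Xs (k + n)%N n.+1 t)).
    by apply/funext => k; apply/funext => t; rewrite mulrA.
  have -> : (fun t => c * X n t * X n.+1 t) = (fun t => c * (X n t * X n.+1 t)).
    by apply/funext => t; rewrite mulrA.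
  apply: loc_unifZ; apply: (@loc_unifM R _ _ _ _ K) => //.
  - by move=> k t t0; apply: XsK => //; apply: leqW; exact: leq_addl.
  - by move=> t t0; exact: XK.
  - exact: (loc_unif_shift n (hX n)).
  - exact: (loc_unif_shift n (hX n.+1)).
exists X; split => // n n1; split.
  apply/eqP; rewrite -subr_eq0 -normr_le0; apply/ler_addgt0Pr => e e0.
  have [k nk] := near_eq n 0 (lexx 0) e e0.
  by rewrite init ?n1 ?leqW// distrC add0r.
split; last exact: dXlim.
have dX0 k t : 0 <= t -> exists l, D (X k) t l.
  move=> t0; case: k => [|k]; last by eexists; apply: dXlim.
  exists 0; apply: (@nderiv_ext R (fun=> 0)) => //; last exact: nderiv_cst.
  by move=> u u0; rewrite X0E.
have cts k : {within `[0, +oo[, continuous (X k)}.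
  pose l t := if pselect (0 <= t) is left h then projT1 (cid (dX0 k t h)) else 0.
  apply: (@nderiv_within_continuous R (X k) l) => t t0; rewrite /l; case: pselect => // h.
  exact: projT2 (cid (dX0 k t h)).
move=> t; apply: cvgB.
  by apply: cvgMr; exact: (cvgM (cts n.-1 t) (cts n.-1 t)).
by apply: cvgM; [apply: cvgMr; exact: cts|exact: cts].
Qed.

Lemma sup_lam_bound gamma x : (sup_lam gamma x < +oo)%E ->
  exists S, forall n, (1 <= n)%N -> (2 `^ gamma) ^+ n * x n <= S.
Proof.
rewrite /sup_lam; set A := (X in ereal_sup X) => fin.
have ub : ubound A (ereal_sup A) by exact: ereal_sup_ubound.
case E : (ereal_sup A) fin ub => [S| |] // _ ub; last first.
  have : A (lam R 1 `^ gamma * x 1%N)%:E by exists 1%N.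
  by move=> /ub; rewrite leeNy_eq.
exists S => n n1; rewrite -lam_powR// -lee_fin; apply: ub.
by exists n.
Qed.

Lemma sup_lam_time_bound gamma (X : nat -> R -> R) : (sup_lam_time gamma X < +oo)%E ->
  exists S, forall n, (1 <= n)%N -> forall t, 0 <= t -> (2 `^ gamma) ^+ n * X n t <= S.
Proof.
rewrite /sup_lam_time; set A := (X in ereal_sup X) => fin.
have ub : ubound A (ereal_sup A) by exact: ereal_sup_ubound.
have ub' n t : (1 <= n)%N -> 0 <= t -> ((lam R n `^ gamma * X n t)%:E <= ereal_sup A)%E.
  move=> n1 t0; apply: (@le_trans _ _ (sup_lam gamma (fun n => X n t))).
    by apply: ereal_sup_ubound; exists n.
  by apply: ub; exists t.
case E : (ereal_sup A) fin ub ub' => [S| |] // _ ub ub'; last first.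
  by have := ub' 1%N 0 isT (lexx _); rewrite leeNy_eq.
by exists S => n n1 t t0; rewrite -lam_powR// -lee_fin; apply: ub'.
Qed.

Lemma sup_lam_time_lty gamma (X : nat -> R -> R) K :
  (forall n, (1 <= n)%N -> forall t, 0 <= t -> (2 `^ gamma) ^+ n * X n t <= K) ->
  (sup_lam_time gamma X < +oo)%E.
Proof.
move=> XK; apply: le_lt_trans (ltry K).
apply: ge_ereal_sup => _ [t /= t0 <-]; apply: ge_ereal_sup => _ [n /= n1 <-].
by rewrite lee_fin lam_powR//; exact: XK.
Qed.

End Existence.

(** * Uniqueness and vanishing viscosity limit *)

Lemma two_powR_bounds (R : realType) (gamma : R) :
  1 / 2 < gamma -> gamma <= ln (17 / 12) / ln 2 ->
  [/\ 1 <= (2 `^ gamma : R), 2 < (2 `^ gamma) ^+ 2 & 2 `^ gamma <= 17 / 12].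
Proof.
move=> g1 g2; have ln2 : 0 < ln (2 : R) by apply: ln_gt0; lra.
have e2 : (2 : R) `^ 1 = 2 by rewrite powRr1.
split.
- by apply: (@le_trans _ _ (2 `^ 0)); [rewrite powRr0|apply: ler_powR; lra].
- rewrite -powR_mulrn ?powR_ge0// -powRrM -[ltLHS]e2 /powR.
  rewrite (_ : (2 == 0 :> R) = false); last by apply/negbTE; rewrite gt_eqF.
  by rewrite ltr_expR ltr_pM2r//; lra.
- apply: (@le_trans _ _ (2 `^ (ln (17 / 12) / ln 2))).
    by apply: ler_powR => //; lra.
  rewrite /powR (_ : (2 == 0 :> R) = false); last by apply/negbTE; rewrite gt_eqF.
  by rewrite divfK ?gt_eqF// lnK// posrE; lra.
Qed.

Lemma uniform_of_sqr_bound (R : realType) (A : set R) (f : R -> R -> R) (g : R -> R) M :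
  0 <= M -> (forall nu t, 0 < nu -> A t -> (f nu t - g t) ^+ 2 <= M * nu) ->
  {uniform A, f nu @[nu --> 0^'+] --> g}.
Proof.
move=> M0 h P; rewrite uniform_nbhs => -[E [entE subP]].
move: entE; rewrite -entourage_ballE => -[e /= e0 subE].
have M1 : 0 < M + 1 by lra.
near=> nu; apply: subP => t At; apply: subE => /=; rewrite /ball/=.
rewrite distrC -(@ltr_pXn2r _ 2) ?nnegrE ?normr_ge0 ?(ltW e0)// -normrX ger0_norm ?sqr_ge0//.
have nu0 : 0 < nu by [].
apply: le_lt_trans (h nu t nu0 At) _.
apply: (@le_lt_trans _ _ ((M + 1) * nu)); first by rewrite ler_pM2r//; lra.
rewrite mulrC -ltr_pdivlMr//; near: nu.
by apply: nbhs_right_lt; rewrite divr_gt0// exprn_gt0.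
Unshelve. all: by end_near. Qed.

Lemma inviscid_unique (R : realType) (s K : R) (x : nat -> R) (X Y : nat -> R -> R) :
  1 <= s -> 2 `^ (5 / 2) / (2 * s ^+ 3) < 1 ->
  (forall n, (1 <= n)%N -> forall t, 0 <= t -> 0 <= X n t <= K / s ^+ n) ->
  (forall n, (1 <= n)%N -> forall t, 0 <= t -> 0 <= Y n t <= K / s ^+ n) ->
  inviscid_solution (5 / 2) x X -> inviscid_solution (5 / 2) x Y ->
  forall n, (1 <= n)%N -> forall t, 0 <= t -> Y n t = X n t.
Proof.
move=> s1 r1 bX bY solX solY n n1 t t0.
have b0 : 5 / 2 != 0 :> R by rewrite gt_eqF//; lra.
set r := 2 `^ (5 / 2) / (2 * s ^+ 3) in r1.
have r0 : 0 <= r by rewrite divr_ge0 ?powR_ge0// mulr_ge0// exprn_ge0//; lra.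
apply/eqP; rewrite -subr_eq0 -sqrf_eq0 eq_le sqr_ge0 andbT.
apply/ler_addgt0Pr => e e0; rewrite add0r.
have [k0 hk] := @geometric_small R (2 ^+ n * (K ^+ 3 * t)) r e r0 r1 e0.
pose N := maxn n k0.
apply: le_trans (hk N (leq_maxr _ _)).
rewrite [leRHS](_ : _ = 2 ^+ n * (K ^+ 3 * r ^+ N * t)); last by ring.
apply: (@inviscid_stability R (5 / 2) s K Y X N b0 s1) => //.
- by move=> k /andP[k1 _] u u0; apply: (solY k k1).2.2.
- by move=> k /andP[k1 _] u u0; apply: (solX k k1).2.2.
- by move=> k /andP[k1 _]; exact: bY.
- by move=> k /andP[k1 _]; exact: bX.
- by move=> k /andP[k1 _]; rewrite (solX k k1).1 (solY k k1).1.
- by rewrite n1 leq_maxl.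
Qed.

Theorem theorem2 (R : realType) :
  exists2 gamma0 : R, 1 / 2 < gamma0 &
  forall gamma : R, 1 / 2 < gamma -> gamma <= gamma0 ->
  forall x : nat -> R,
    (forall n : nat, (1 <= n)%N -> 0 <= x n) ->
    (sup_lam gamma x < +oo)%E ->
  exists X : nat -> R -> R,
    [/\ inviscid_solution (5 / 2) x X,
        (sup_lam_time gamma X < +oo)%E,
        (forall Y : nat -> R -> R,
           inviscid_solution (5 / 2) x Y ->
           (sup_lam_time gamma Y < +oo)%E ->
           forall n : nat, (1 <= n)%N -> forall t : R, 0 <= t -> Y n t = X n t)
      & forall Xnu : R -> nat -> R -> R,
          (forall nu : R, 0 < nu -> viscous_solution (5 / 2) nu x (Xnu nu)) ->
          forall n : nat, (1 <= n)%N ->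
          forall K : set R, compact K -> K `<=` `[0, +oo[ ->
            {uniform K, Xnu nu n @[nu --> 0^'+] --> X n}].
Proof.
(* The exponent for which 2 ^ gamma0 = 17/12, the largest value of s in
   [scaling_constants]. *)
exists (ln (17 / 12) / ln 2).
  have ln2 : 0 < ln (2 : R) by apply: ln_gt0; lra.
  rewrite ltr_pdivlMr//.
  have : ln (2 : R) < ln ((17 / 12) ^+ 2).
    by rewrite ltr_ln ?posrE ?exprn_gt0//; lra.
  by rewrite lnXn; lra.
move=> gamma g1 g2 x x0 /sup_lam_bound[S xS].
have [s1 ss s2] := two_powR_bounds g1 g2.
set s := 2 `^ gamma in xS s1 ss s2.
have s0 : 0 < s by exact: lt_le_trans s1.
have s_le2 : s <= 2 by lra.
have b0 : 5 / 2 != 0 :> R by rewrite gt_eqF//; lra.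
have sn n : 0 < s ^+ n by rewrite exprn_gt0.
have [_ _ _ /andP[_ r1] rho1] := scaling_constants s0 ss s2.
pose K := 2 * Num.max 1 S.
have K0 : 0 < K by rewrite mulr_gt0// lt_max ltr01.
have xK n : (1 <= n)%N -> s ^+ n * x n <= K / 2.
  move=> n1; apply: le_trans (xS n n1) _.
  by rewrite /K mulrC mulKf// le_max lexx orbT.
have [X [solX bX]] := inviscid_exists s0 ss s2 K0 x0 xK.
exists X; split => //.
- apply: (@sup_lam_time_lty R gamma X K) => n n1 t t0.
  by rewrite mulrC -ler_pdivlMr//; case/andP: (bX n n1 t t0).
- move=> Y solY /sup_lam_time_bound[S' YS'].
  pose K' := Num.max K S'.
  apply: (@inviscid_unique R s K' x X Y s1 r1) => // n n1 t t0.
    have /andP[-> /= h] := bX n n1 t t0; apply: le_trans h _.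
    by rewrite ler_pM2r ?invr_gt0// le_max lexx.
  rewrite (viscous_solution_ge0 x0 (inviscid_is_viscous0 solY))//=.
  rewrite ler_pdivlMr// mulrC; apply: le_trans (YS' n n1 t t0) _.
  by rewrite le_max lexx orbT.
- move=> V solV n n1 A cA Ann.
  have [B [_ hB]] := compact_bounded cA.
  pose T := Num.max 0 (B + 1).
  have AT t : A t -> 0 <= t <= T.
    move=> At; have := Ann t At; rewrite /= in_itv/= andbT => t0; rewrite t0/=.
    have := hB (B + 1); rewrite ltrDl ltr01 => /(_ isT t At).
    by move=> /=; rewrite ger0_norm// => h; rewrite le_max h orbT.
  have T0 : 0 <= T by rewrite le_max lexx.
  pose c := K ^+ 2 / 2 / (1 - 2 / s ^+ 2).
  have c0 : 0 <= c.
    apply: divr_ge0; first by rewrite divr_ge0// exprn_ge0// ltW.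
    by rewrite subr_ge0 ler_pdivrMr// mul1r ltW.
  apply: (@uniform_of_sqr_bound R A (fun nu => V nu n) (X n) (2 ^+ n * (c * T))).
    by rewrite mulr_ge0 ?exprn_ge0// mulr_ge0.
  move=> nu t nu0 /AT /andP[t0 tT].
  have := viscous_stability b0 s1 s_le2 ss rho1 (ltW K0) nu0 bX solX (solV nu nu0) n1 t0.
  rewrite -/c => /le_trans; apply.
  rewrite [leLHS](_ : _ = 2 ^+ n * (c * t) * nu); last by ring.
  rewrite ler_pM2r//; apply: ler_wpM2l; first exact: exprn_ge0.
  exact: ler_wpM2l.
Qed.
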